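(* Let $\nu>-1$. Then the radius of uniform convexity $r^{uc}(g_\nu)$ of the function $z\mapsto g_\nu(z)=2^\nu\Gamma(\nu+1)z^{1-\nu}J_\nu(z)$ is the smallest positive root of the equation $$g_\nu'(z)+2zg_\nu''(z)=0$$ and satisfies, for every positive integer $k$, the inequality $$\omega_k^{-\frac1k}<\left(r^{uc}(g_\nu)\right)^2<\frac{\omega_k}{\omega_{k+1}},$$ where $\omega_1,\omega_2,\ldots$ are given by $$-2\,\omega_{n+1}=\sum_{m=0}^{n}\pi_m\,\xi_{n-m},\qquad n\ge 0,$$ with $$\xi_n=\frac{(-1)^{n+1}\,2(2n+3)(4n+5)}{2^{2n+2}\,n!\,(\nu+1)_{n+1}},\qquad \kappa_n=\frac{(-1)^n(2n+1)(4n+1)}{2^{2n}\,n!\,(\nu+1)_n},\qquad f_n=\frac{\kappa_{n+1}}{\kappa_1},$$ $$\pi_0=1,\qquad \pi_m=\sum_{p=1}^{m}(-1)^p\kappa_1^p\,A_{m,m-p}(f_1,\ldots,f_{m-p})\quad (m\ge1).$$ In particular, for $k=1$, $$2\sqrt{\frac{\nu+1}{15}}<r^{uc}(g_\nu)<2\sqrt{\frac{\nu(\nu+1)}{3(4\nu-1)}}.$$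
   Context: $J_\nu$ is the Bessel function of the first kind of real order $\nu$; $g_\nu(z)=\sum_{n\ge0}\frac{(-1)^n z^{2n+1}}{4^n n!\,(\nu+1)_n}$ is entire, with $(a)_n=a(a+1)\cdots(a+n-1)$, $(a)_0=1$. For a function $f(z)=z+a_2z^2+\cdots$, the radius of convexity is $$r^c(f)=\sup\left\{r\in(0,\infty):\ \operatorname{Re}\left(1+\frac{zf''(z)}{f'(z)}\right)>0\ \text{for all } |z|<r\right\}$$ and the radius of uniform convexity is $$r^{uc}(f)=\sup\left\{r\in(0,r^c(f)):\ \operatorname{Re}\left(1+\frac{zf''(z)}{f'(z)}\right)>\left|\frac{zf''(z)}{f'(z)}\right|\ \text{for all } |z|<r\right\}.$$ The ordinary potential polynomials $A_{m,n}(f_1,\ldots,f_n)$ are defined by $\left(1+\sum_{n\ge1}f_nx^n\right)^m=\sum_{n\ge0}A_{m,n}(f_1,\ldots,f_n)x^n$; explicitly $$A_{m,n}(f_1,\ldots,f_n)=\sum\binom{m}{p}\frac{p!}{p_1!\cdots p_n!}f_1^{p_1}\cdots f_n^{p_n},$$ the sum being over all nonnegative integers $p_1,\ldots,p_n$ with $p_1+2p_2+\cdots+np_n=n$, where $p=p_1+\cdots+p_n$; $A_{m,0}=1$.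
   Formalization: In π_m, A_{m,m-p} is corrected to A_{p,m-p} (as printed the inequality fails at ν=0, k=3); the printed upper bound for k=1 fails for ν≤1/4, so it is stated only for ν>1/4, and the bound 2√((ν+1)(ν+2)/(3(4ν+9))) is given for all ν>-1. *)

(* Defs.v *)
From mathcomp Require Import all_boot all_order all_algebra.
From mathcomp Require Import all_classical all_reals all_analysis.
From mathcomp.real_closed Require Import complex.

Set Implicit Arguments.
Unset Strict Implicit.
Unset Printing Implicit Defensive.

Import Order.TTheory GRing.Theory Num.Theory.
Import numFieldNormedType.Exports.

Local Open Scope ring_scope.
Local Open Scope complex_scope.
Local Open Scope classical_set_scope.

(* The complex numbers are R[i] for R : realType. The alias R[i]^o carries the *)
(* topology of the modulus.                                                    *)

Definition cderiv (R : realType) (f : R[i] -> R[i]) : R[i] -> R[i] :=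
  derive1 (f : R[i] -> R[i]^o).

Definition cseries (R : realType) (u : nat -> R[i]) : R[i] :=
  limn (series (u : nat -> R[i]^o)).

Definition rising (R : realType) (a : R) (n : nat) : R :=
  \prod_(i < n) (a + i%:R).

(* Gauss's product. At the poles 0, -1, -2, ... the approximants vanish        *)
(* eventually because x / 0 = 0, so (gamma x)^-1 = 0 there, which is the usual *)
(* value of 1 / Gamma.                                                         *)
Definition gamma (R : realType) (x : R) : R :=
  limn (fun n : nat => n`!%:R * n%:R `^ x / rising x n.+1 : R).

(* Argument in ]-pi, pi] (z != 0). *)
Definition carg (R : realType) (z : R[i]) : R :=
  let t := acos (complex.Re z / ComplexField.Normc.normc z) in
  if 0 <= complex.Im z then t else - t.

(* Principal branch of z ^ a for a real exponent a (z != 0). *)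
Definition cpow (R : realType) (z : R[i]) (a : R) : R[i] :=
  (ComplexField.Normc.normc z `^ a)%:C
    * (cos (a * carg z) +i* sin (a * carg z)).

Definition besselJ (R : realType) (nu : R) (z : R[i]) : R[i] :=
  cseries (fun n => ((-1) ^+ n / (n`!%:R * gamma (n%:R + nu + 1)))%:C
                      * cpow (z / 2) ((2 * n)%:R + nu)).

Definition g (R : realType) (nu : R) (z : R[i]) : R[i] :=
  cseries (fun n => ((-1) ^+ n / (4 ^+ n * n`!%:R * rising (nu + 1) n))%:C
                      * z ^+ (2 * n + 1)).

(* z f''(z) / f'(z) *)
Definition convexity_quotient (R : realType) (f : R[i] -> R[i]) (z : R[i]) :
    R[i] :=
  z * cderiv (cderiv f) z / cderiv f z.

(* The two radii are suprema in the extended reals. Since division is total,   *)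
(* definedness of the quotient is stated as f'(z) != 0.                        *)
Definition radius_convexity (R : realType) (f : R[i] -> R[i]) : \bar R :=
  ereal_sup [set r%:E | r in [set r : R | 0 < r /\
    forall z : R[i], `|z| < r%:C ->
      cderiv f z != 0 /\ 0 < complex.Re (1 + convexity_quotient f z)]].

Definition radius_uniform_convexity (R : realType) (f : R[i] -> R[i]) :
    \bar R :=
  ereal_sup [set r%:E | r in [set r : R |
    [/\ 0 < r, (r%:E < radius_convexity f)%E &
    forall z : R[i], `|z| < r%:C ->
      cderiv f z != 0 /\
      ComplexField.Normc.normc (convexity_quotient f z)
        < complex.Re (1 + convexity_quotient f z)]]].

Definition smallest_positive_root (R : realType) (F : R[i] -> R[i]) (r : R) :=
  [/\ 0 < r, F r%:C = 0 & forall s : R, 0 < s -> F s%:C = 0 -> r <= s].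

(* A_(m,n)(f_1, ..., f_n): coefficient of x^n in (1 + f_1 x + f_2 x^2 + ...)^m; *)
(* the terms f_i x^i with i > n do not contribute to it.                       *)
Definition potential (R : realType) (m n : nat) (f : nat -> R) : R :=
  ((1 + \sum_(1 <= i < n.+1) f i *: 'X^i : {poly R}) ^+ m)`_n.

Definition xi (R : realType) (nu : R) (n : nat) : R :=
  (-1) ^+ n.+1 * (2 * (2 * n + 3) * (4 * n + 5))%:R
    / (2 ^+ (2 * n + 2) * n`!%:R * rising (nu + 1) n.+1).

Definition kappa (R : realType) (nu : R) (n : nat) : R :=
  (-1) ^+ n * ((2 * n + 1) * (4 * n + 1))%:R
    / (2 ^+ (2 * n) * n`!%:R * rising (nu + 1) n).

Definition fcoef (R : realType) (nu : R) (n : nat) : R :=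
  kappa nu n.+1 / kappa nu 1.

(* pi_m is the coefficient of x^m in 1 / (1 + kappa_1 x + kappa_2 x^2 + ...).  *)
(* Expanding this as a geometric series in                                     *)
(* kappa_1 x (1 + f_1 x + f_2 x^2 + ...) shows that the potential polynomial   *)
(* in the p-th term has exponent p, i.e. it is A_(p,m-p).                      *)
Definition picoef (R : realType) (nu : R) (m : nat) : R :=
  if m == 0%N then 1
  else \sum_(1 <= p < m.+1)
         (-1) ^+ p * kappa nu 1 ^+ p * potential p (m - p) (fcoef nu).

(* -2 omega_(n+1) = \sum_(m <= n) pi_m xi_(n-m), with k = n + 1. The value at  *)
(* k = 0 is not used.                                                          *)
Definition omega (R : realType) (nu : R) (k : nat) : R :=
  - (\sum_(m < k) picoef nu m * xi nu (k.-1 - m)) / 2.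

(* Main.v *)
Require Import Defs.
From mathcomp Require Import all_boot all_order all_algebra.
From mathcomp Require Import all_classical all_reals all_analysis.
From mathcomp.real_closed Require Import complex.
From mathcomp Require Import ring lra zify.

(** Put x = z^2 and b_n = (-1)^n / (4^n n! (nu+1)_n), so that
    g_nu(z) = z sum b_n x^n.  Then g_nu'(z) = G(x) with coefficients
    G_n = (2n+1) b_n, and g_nu'(z) + 2 z g_nu''(z) = G(x) + 4 x G'(x) = P(x)
    with coefficients P_n = (4n+1) G_n = kappa_n.  The whole argument concerns
    the zeros of the two entire functions G and P; instead of a Hadamard
    factorization, it uses that both are limits, coefficient by coefficient, of
    polynomials prod (1 - y_j x) with all y_j > 0.

    These polynomials come from one operation: if all the zeros of p are real
    and positive, then so are those of (a - b x) p + x p' for a > 0 and b >= 0,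
    because for nonconstant p the quantity a - b z + z p'(z) / p(z) has a nonzero
    imaginary part off the real axis and is positive for z <= 0
    (recip_prod_rolle_op).  With b = 1 it builds the Laguerre polynomials, whose
    coefficients tend to b_n after the substitution x -> x / (4N)
    (lp_limit_bessel); with b = 0 it multiplies the n-th coefficient by
    a + n (lp_limit_rolle_op).

    Let C = G or P and let -C'/C = sum w_n x^n.  By Newton's identities w_n is
    the limit of the power sums sum_j y_j^(n+1), and finite inequalities pass to
    the limit: w_n >= 0, w is log-convex and w_(i+j+1) <= w_i w_j.  So the ratios
    w_(n+1) / w_n increase to a number L, called rate below, with
    L^(n+1) <= w_n <= w_0 L^n.  Moreover 1/L is the smallest zero of C: the
    coefficients of 1/C satisfy a recurrence in w which makes 1/C converge for
    |x| < 1/L (cps_neq0), while -C'/C is at least L / (1 - L x), so that C must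
    vanish at 1/L (cps_root).

    For C = P the number w_(k-1) is omega_k (omega_log_deriv), and the bounds
    L^k < omega_k and omega_(k+1) < L omega_k are the stated inequalities for
    r^2 = 1/L.  They are strict because the discriminants
    w_n w_(n+2) - w_(n+1)^2 also form a log-convex sequence, and one of them is
    positive by an explicit computation (kappa_log_deriv).

    For the radius, let S(x) = - x G'(x) / G(x), whose coefficients are
    nonnegative, so that |S(x)| <= S(|x|).  Then z g''/g' = - 2 S(z^2) and
    P = G (1 - 4 S), hence the smallest zero X of P is where S reaches 1/4
    (theta_log_first_root).  For |z|^2 < X the quotient has modulus less than 1/2,
    which is enough for uniform convexity; at z^2 = X it equals -1/2 and the
    strict inequality fails.  Convexity itself persists until S reaches 1/2.

    The first assertion is a termwise comparison of two series that rests on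
    gamma (x + 1) = x gamma x, proved from the convergence of Gauss's product. *)

Import Order.TTheory GRing.Theory Num.Theory.
Import numFieldNormedType.Exports.
Local Open Scope ring_scope.
Local Open Scope complex_scope.
Set Implicit Arguments.
Unset Strict Implicit.
Unset Printing Implicit Defensive.

Local Notation normc := ComplexField.Normc.normc.


(** * Cauchy products and formal logarithmic derivatives *)

Lemma mulr_geometric_sum (R : pzRingType) (q : R) n :
  (1 - q) * (\sum_(p < n) q ^+ p) = 1 - q ^+ n.
Proof. by rewrite -[RHS]opprB subrX1 -mulNr opprB. Qed.

Section Convolution.
Variable R : comNzRingType.
Implicit Types a b c : nat -> R.

Definition convol a b (n : nat) : R := \sum_(i < n.+1) a i * b (n - i)%N.

Lemma convol_eq a a' b b' n :
  (forall i, (i <= n)%N -> a i = a' i) -> (forall i, (i <= n)%N -> b i = b' i) ->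
  convol a b n = convol a' b' n.
Proof.
move=> ha hb; apply: eq_bigr => i _.
by rewrite ha ?hb ?leq_subr // -ltnS.
Qed.

Lemma convol_coef (p q : {poly R}) n : convol (nth 0 p) (nth 0 q) n = (p * q)`_n.
Proof. by rewrite coefM. Qed.

Lemma convol_trunc a b n m : (n < m)%N ->
  convol a b n = ((\poly_(i < m) a i) * (\poly_(i < m) b i))`_n.
Proof.
move=> nm; rewrite -convol_coef; apply: convol_eq => i hi;
  by rewrite coef_poly (leq_ltn_trans hi nm).
Qed.

Lemma convolC a b : convol a b = convol b a.
Proof. by apply/funext => n; rewrite !(convol_trunc _ _ (ltnSn n)) mulrC. Qed.

Lemma convolA a b c : convol a (convol b c) = convol (convol a b) c.
Proof.
have trunc n u v i : (i <= n)%N ->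
    convol u v i = ((\poly_(i < n.+1) u i) * (\poly_(i < n.+1) v i))`_i.
  by move=> hi; apply: convol_trunc; rewrite ltnS.
apply/funext => n.
rewrite (@convol_eq _ (nth 0 (\poly_(i < n.+1) a i)) _
  (nth 0 ((\poly_(i < n.+1) b i) * (\poly_(i < n.+1) c i)))); last 2 first.
- by move=> i hi; rewrite coef_poly ltnS hi.
- by move=> i hi; rewrite (trunc n).
rewrite convol_coef mulrA -convol_coef; apply: convol_eq => i hi.
- by rewrite (trunc n).
- by rewrite coef_poly ltnS hi.
Qed.

Definition delta0 (n : nat) : R := (n == 0%N)%:R.

Lemma convol_delta0 a : convol delta0 a = a.
Proof.
apply/funext => n; rewrite /convol big_ord_recl /delta0 /= mul1r subn0 big1 ?addr0 //.
by move=> i _; rewrite mul0r.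
Qed.

Lemma coef_exp_eq (p q : {poly R}) n m : (forall i, (i <= n)%N -> p`_i = q`_i) ->
  (p ^+ m)`_n = (q ^+ m)`_n.
Proof.
elim: m n => [|m IH] n h; first by rewrite !expr0.
rewrite !exprS -!convol_coef; apply: convol_eq => // i hi.
by apply: IH => j hj; apply: h; apply: leq_trans hi.
Qed.

Lemma coef_exp_small (q : {poly R}) p n : q`_0 = 0 -> (n < p)%N -> (q ^+ p)`_n = 0.
Proof.
move=> q0; elim: p n => // p IH n np.
rewrite exprS coefM big1 // => -[[|i] hi] _ /=; first by rewrite q0 mul0r.
rewrite ltnS in hi.
by rewrite IH ?mulr0 // -ltnS (leq_trans _ np) // ltnS ltn_subrL /= (leq_ltn_trans _ hi).
Qed.

(** The coefficients of 1/c when c 0 = 1: the geometric series in 1 - c, truncated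
    where its later terms cannot reach the n-th coefficient. *)
Definition inv_series c n : R :=
  (\sum_(p < n.+1) (1 - \poly_(i < n.+1) c i) ^+ p)`_n.

Lemma inv_series_trunc c n m : c 0%N = 1 -> (n <= m)%N ->
  inv_series c n = (\sum_(p < m.+1) (1 - \poly_(i < m.+1) c i) ^+ p)`_n.
Proof.
move=> c0 nm; have q0 : (1 - \poly_(i < m.+1) c i)`_0 = 0.
  by rewrite coefB coef1 coef_poly /= c0 subrr.
rewrite /inv_series !coef_sum.
rewrite -(big_mkord xpredT (fun p => ((1 - \poly_(i < n.+1) c i) ^+ p)`_n)).
rewrite -(big_mkord xpredT (fun p => ((1 - \poly_(i < m.+1) c i) ^+ p)`_n)).
rewrite (@big_cat_nat _ _ _ n.+1 0 m.+1) //= [X in _ = _ + X]big1_seq ?addr0.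
  apply: eq_bigr => p _; apply: coef_exp_eq => i hi.
  by rewrite !coefB !coef_poly !ltnS hi (leq_trans hi nm).
by move=> p /andP[_]; rewrite mem_index_iota => /andP[np _]; exact: coef_exp_small.
Qed.

Lemma convol_inv_series c : c 0%N = 1 -> convol c (inv_series c) = delta0.
Proof.
move=> c0; apply/funext => n; set q := 1 - \poly_(i < n.+1) c i.
have q0 : q`_0 = 0 by rewrite coefB coef1 coef_poly /= c0 subrr.
transitivity (((1 - q) * \sum_(p < n.+1) q ^+ p)`_n).
  rewrite -convol_coef; apply: convol_eq => i hi; last by rewrite (inv_series_trunc c0 hi).
  by rewrite opprB addrC subrK coef_poly ltnS hi.
by rewrite mulr_geometric_sum coefB coef1 coef_exp_small // subr0.
Qed.

Definition dcoef a n : R := n.+1%:R * a n.+1.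

Lemma dcoef_convol a b n :
  dcoef (convol a b) n = convol (dcoef a) b n + convol a (dcoef b) n.
Proof.
rewrite /dcoef (convol_trunc _ _ (ltnSn n.+1)) mulr_natl -coef_deriv derivM coefD.
rewrite -!convol_coef; congr (_ + _); apply: convol_eq => i hi;
  by rewrite ?coef_deriv coef_poly !ltnS ?hi ?(leqW hi) ?mulr_natl.
Qed.

(** With the minus sign, -c'/c is the generating function of the power sums of the
    reciprocal zeros of c. *)
Definition neg_log_deriv c n : R := - convol (inv_series c) (dcoef c) n.

Lemma convolNr a b : convol a (fun n => - b n) = fun n => - convol a b n.
Proof.
by apply/funext => n; rewrite /convol -sumrN; apply: eq_bigr => i _; rewrite mulrN.
Qed.

Lemma convol_log_deriv c n : c 0%N = 1 -> convol c (neg_log_deriv c) n = - dcoef c n.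
Proof.
by move=> c0; rewrite convolNr convolA convol_inv_series // convol_delta0.
Qed.

(** This is (1/c)' = (-c'/c) (1/c); read on coefficients it is a recurrence for
    1/c in terms of the power sums, from which inv_series_bound is obtained. *)
Lemma dcoef_inv_series c : c 0%N = 1 ->
  dcoef (inv_series c) = convol (neg_log_deriv c) (inv_series c).
Proof.
move=> c0; have ch := convol_inv_series c0.
have e : convol c (dcoef (inv_series c)) =
    fun n => - convol (dcoef c) (inv_series c) n.
  apply/funext => n; apply/eqP; rewrite -addr_eq0 addrC -dcoef_convol ch.
  by rewrite /dcoef /delta0 mulr0.
rewrite -[LHS]convol_delta0 -ch [convol c _]convolC -convolA e convolNr.
rewrite [RHS]convolC.
rewrite (_ : neg_log_deriv c = fun n => - convol (inv_series c) (dcoef c) n) //.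
by rewrite convolNr [convol (dcoef c) _]convolC.
Qed.

End Convolution.
Arguments delta0 {R}.

Section Omega.
Variables (R : realType) (nu : R).
Hypothesis hnu : -1 < nu.

Lemma rising_gt0 (a : R) n : 0 < a -> 0 < rising a n.
Proof. by move=> ha; apply: prodr_gt0 => i _; apply: ltr_wpDr. Qed.

Lemma nu1_gt0 : 0 < nu + 1. Proof. by rewrite -ltrBlDr sub0r. Qed.

Lemma rising1 (a : R) : rising a 1 = a.
Proof. by rewrite /rising big_ord1 addr0. Qed.

Lemma risingS (a : R) n : rising a n.+1 = rising a n * (a + n%:R).
Proof. by rewrite /rising big_ord_recr. Qed.

Lemma rising_shift (a : R) n : rising (a + 1) n * a = rising a n.+1.
Proof.
rewrite /rising big_ord_recl /= addr0 mulrC; congr (_ * _).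
by apply: eq_bigr => i _; rewrite -addrA [1 + _]addrC natr1.
Qed.

Lemma kappa0 : kappa nu 0 = 1.
Proof. by rewrite /kappa /rising big_ord0 !expr0 /= !mulr1 divr1. Qed.

Lemma kappa1_neq0 : kappa nu 1 != 0.
Proof.
have h : 0 < 2 ^+ (2 * 1) * 1`!%:R * rising (nu + 1) 1.
  by rewrite mulr_gt0 ?rising_gt0 ?nu1_gt0.
apply: mulf_neq0; last by rewrite invr_neq0 // gt_eqF.
by apply: mulf_neq0; rewrite ?signr_eq0 ?pnatr_eq0.
Qed.

(** Since 1 - sum kappa_i x^i = - kappa_1 x (f_0 + f_1 x + ...) with f_0 = 1, the
    p-th power in the geometric series contributes A_(p, m-p) to the coefficient of x^m. *)
Lemma picoef_inv_series m : picoef nu m = inv_series (kappa nu) m.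
Proof.
have k1 := kappa1_neq0.
have poly_kappa : 1 - \poly_(i < m.+1) kappa nu i =
    - kappa nu 1 *: ('X * \poly_(i < m) fcoef nu i).
  apply/polyP => -[|i]; rewrite coefB coef1 coefZ coefXM coef_poly /=.
    by rewrite kappa0 subrr mulr0.
  rewrite coef_poly sub0r ltnS; case: ifP => _; last by rewrite oppr0 mulr0.
  by rewrite mulNr /fcoef mulrC divfK.
have termE p : ((1 - \poly_(i < m.+1) kappa nu i) ^+ p)`_m =
    if (m < p)%N then 0
    else (- kappa nu 1) ^+ p * ((\poly_(i < m) fcoef nu i) ^+ p)`_(m - p).
  rewrite poly_kappa exprZn coefZ exprMn coefXnM.
  by case: ifP => // _; rewrite mulr0.
have truncE n :
    1 + \sum_(1 <= i < n.+1) fcoef nu i *: 'X^i = \poly_(i < n.+1) fcoef nu i.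
  rewrite poly_def -(big_mkord xpredT (fun i => fcoef nu i *: 'X^i)).
  by rewrite [RHS]big_ltn // expr0 /fcoef divff // scale1r.
rewrite /inv_series coef_sum; under [RHS]eq_bigr do rewrite termE.
rewrite -(big_mkord xpredT (fun p => if (m < p)%N then 0
   else (- kappa nu 1) ^+ p * ((\poly_(i < m) fcoef nu i) ^+ p)`_(m - p))).
rewrite /picoef big_ltn //= !expr0 mul1r subn0 coef1.
case: ifPn => [/eqP ->|m0]; first by rewrite big_geq ?addr0.
rewrite add0r; apply: eq_big_nat => p /andP[p1 pm]; rewrite ltnNge -ltnS pm /=.
rewrite -exprMn mulN1r; congr (_ * _); rewrite /potential truncE.
apply: coef_exp_eq => i hi; rewrite !coef_poly ltnS hi.
by rewrite (leq_ltn_trans hi) // ltn_subrL p1 lt0n.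
Qed.

(** Because xi_n = 2 (n+1) kappa_(n+1), the sum that defines omega is the n-th
    coefficient of -P'/P, where P = sum kappa_n x^n. *)
Lemma omega_log_deriv n : omega nu n.+1 = neg_log_deriv (kappa nu) n.
Proof.
have xiE j : xi nu j = 2 * (j.+1%:R * kappa nu j.+1).
  rewrite /xi /kappa.
  have -> : (2 * j.+1 = 2 * j + 2)%N by lia.
  have -> : (2 * (2 * j + 3) * (4 * j + 5) = 2 * ((2 * j + 2 + 1) * (4 * j.+1 + 1)))%N.
    by lia.
  have f0 : j`!%:R != 0 :> R by rewrite pnatr_eq0 -lt0n fact_gt0.
  have s0 : j.+1%:R != 0 :> R by rewrite pnatr_eq0.
  have r0 : rising (nu + 1) j.+1 != 0 by rewrite gt_eqF // rising_gt0 // nu1_gt0.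
  have p0 : 2 ^+ (2 * j + 2) != 0 :> R by rewrite expf_neq0.
  rewrite factS !natrM; field; rewrite ?r0 ?f0 ?p0 ?andbT /=.
  by rewrite -natr1 in s0.
rewrite /omega /neg_log_deriv mulNr mulr_suml; congr (- _); apply: eq_bigr => i _ /=.
by rewrite picoef_inv_series xiE /dcoef; field.
Qed.

End Omega.

(** * Polynomials whose roots are all real and positive *)

Section ReciprocalProduct.
Variable F : fieldType.
Implicit Types (ys : seq F) (z : F).

(** Parametrizing by the reciprocals of the roots normalizes the value at 0 to 1 and
    keeps the sums over roots bounded when the degree tends to infinity. *)
Definition recip_prod ys : {poly F} := \prod_(y <- ys) (1 - y *: 'X).

Lemma recip_prod_cons y ys :
  recip_prod (y :: ys) = (1 - y *: 'X) * recip_prod ys.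
Proof. by rewrite /recip_prod big_cons. Qed.

Lemma recip_prod_nil : recip_prod [::] = 1.
Proof. by rewrite /recip_prod big_nil. Qed.

Lemma recip_prod_at0 ys : (recip_prod ys).[0] = 1.
Proof.
elim: ys => [|y ys IH]; first by rewrite recip_prod_nil hornerC.
by rewrite recip_prod_cons hornerM IH !hornerE ?mulr0 ?subr0.
Qed.

Lemma recip_prod_deriv ys z : {in ys, forall y, 1 - y * z != 0} ->
  (recip_prod ys)^`().[z] =
  - (recip_prod ys).[z] * \sum_(y <- ys) y / (1 - y * z).
Proof.
elim: ys => [|y ys IH] hz.
  by rewrite recip_prod_nil big_nil mulr0 derivC hornerC.
have y0 : 1 - y * z != 0 by apply: hz; rewrite mem_head.
rewrite recip_prod_cons big_cons derivM hornerD !hornerM IH; last first.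
  by move=> x hx; apply: hz; rewrite in_cons hx orbT.
rewrite derivB derivZ derivX (_ : 1 = 1%:P) // derivC sub0r !(hornerD, hornerN, hornerZ, hornerX, hornerC); field.
by rewrite y0.
Qed.

Lemma recip_prod_root ys z : (recip_prod ys).[z] = 0 ->
  exists2 y, y \in ys & 1 - y * z = 0.
Proof.
elim: ys => [|y ys IH]; first by rewrite recip_prod_nil hornerC => /eqP; rewrite oner_eq0.
rewrite recip_prod_cons hornerM !hornerE => /eqP; rewrite mulf_eq0 => /orP[/eqP h|/eqP /IH[x hx h]].
  by exists y => //; rewrite mem_head.
by exists x => //; rewrite in_cons hx orbT.
Qed.

End ReciprocalProduct.

Lemma recip_prod_map (F K : fieldType) (f : {rmorphism F -> K}) ys :
  map_poly f (recip_prod ys) = recip_prod (map f ys).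
Proof.
rewrite /recip_prod rmorph_prod big_map; apply: eq_bigr => y _.
by rewrite rmorphB rmorph1 /= map_polyZ map_polyX.
Qed.

Section RealRoots.
Variable R : rcfType.
Implicit Types (ys : seq R).
Local Notation toC := (real_complex R).

Definition all_pos ys := {in ys, forall y, 0 < y}.

Lemma all_pos_cons y ys : all_pos (y :: ys) -> 0 < y /\ all_pos ys.
Proof.
move=> h; split; first by apply: h; rewrite mem_head.
by move=> x hx; apply: h; rewrite in_cons hx orbT.
Qed.

(** For b = 0 this is x^(1-a) (x^a p)', and for b = 1 it is
    x^(1-a) e^x (x^a e^(-x) p)'. *)
Definition rolle_op (a b : R) (p : {poly R}) : {poly R} :=
  a *: p - b *: ('X * p) + 'X * p^`().

Lemma ImD (x y : R[i]) : complex.Im (x + y) = complex.Im x + complex.Im y.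
Proof. by case: x y => ? ? []. Qed.

Lemma ImB (x y : R[i]) : complex.Im (x - y) = complex.Im x - complex.Im y.
Proof. by case: x y => ? ? []. Qed.

(** Each term y z / (1 - y z) of the logarithmic derivative has an imaginary part of
    the same sign as that of z; this is what forces the roots to be real. *)
Lemma Im_log_term (y u v : R) : v != 0 -> 0 < y ->
  exists2 s, 0 < s &
    complex.Im (y%:C * (u +i* v) / (1 - y%:C * (u +i* v))) = v * s.
Proof.
move=> v0 y0; exists (y / ((1 - y * u) ^+ 2 + (y * v) ^+ 2)).
  by rewrite divr_gt0 // ltr_wpDl ?sqr_ge0 // exprn_even_gt0 //= mulf_neq0 // gt_eqF.
have h : (1 - y * u) ^+ 2 + (y * v) ^+ 2 != 0.
  by rewrite gt_eqF // ltr_wpDl ?sqr_ge0 // exprn_even_gt0 //= mulf_neq0 // gt_eqF.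
by simpc => /=; rewrite sqrrN; field.
Qed.

Lemma Im_log_sum ys (u v : R) : v != 0 -> all_pos ys ->
  exists s, [/\ 0 <= s, ys != [::] -> 0 < s &
    complex.Im (\sum_(y <- map toC ys) y * (u +i* v) / (1 - y * (u +i* v))) = v * s].
Proof.
move=> v0; elim: ys => [|y ys IH] hy.
  by exists 0; rewrite big_nil mulr0.
have [y0 /IH[s [s0 _ hs]]] := all_pos_cons hy.
have [t t0 ht] := Im_log_term u v0 y0.
exists (t + s); split; [exact/addr_ge0/s0/ltW|by move=> _; exact: ltr_wpDr|].
by rewrite map_cons big_cons ImD ht hs mulrDr.
Qed.

Lemma log_sum_le0 ys (u : R) : u <= 0 -> all_pos ys ->
  \sum_(y <- ys) y * u / (1 - y * u) <= 0.
Proof.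
move=> u0 hy; rewrite big_seq; apply: sumr_le0 => y /hy y0.
have yu : y * u <= 0 by rewrite pmulr_rle0.
by rewrite pmulr_lle0 // invr_gt0; lra.
Qed.

Lemma rolle_op_horner (a b : R) ys z : {in map toC ys, forall y, 1 - y * z != 0} ->
  (map_poly toC (rolle_op a b (recip_prod ys))).[z] =
  (recip_prod (map toC ys)).[z] *
  (a%:C - b%:C * z - \sum_(y <- map toC ys) y * z / (1 - y * z)).
Proof.
move=> hz.
rewrite /rolle_op rmorphD rmorphB /= !map_polyZ !rmorphM /= map_polyX -deriv_map.
rewrite recip_prod_map !(hornerD, hornerN, hornerZ, hornerM, hornerX).
rewrite recip_prod_deriv //.
have -> : \sum_(y <- map toC ys) y * z / (1 - y * z) =
   z * \sum_(y <- map toC ys) y / (1 - y * z).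
  by rewrite mulr_sumr; apply: eq_bigr => y _; rewrite mulrA [z * y]mulrC.
ring.
Qed.

Lemma rolle_op_at0 a b (p : {poly R}) : (rolle_op a b p).[0] = a * p.[0].
Proof. by rewrite /rolle_op !(hornerD, hornerN, hornerZ, hornerM, hornerX); ring. Qed.

(** At a root z which is not a root of p, a - b z equals the sum of the terms
    y z / (1 - y z).  The imaginary parts are - b Im z and, unless p is constant, a
    positive multiple of Im z, so z is real; and for z <= 0 the left-hand side is positive while the sum is not. *)
Lemma rolle_op_root_pos (a b : R) ys (z : R[i]) : 0 < a -> 0 <= b -> all_pos ys ->
  root (map_poly toC (rolle_op a b (recip_prod ys))) z ->
  exists2 t, 0 < t & z = t%:C.
Proof.
move=> a0 b0 hy /rootP hz.
have [pz|pz] := eqVneq (recip_prod (map toC ys)).[z] 0.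
  have [y' /mapP[y yys ->] e] := recip_prod_root pz.
  have y0 := hy _ yys.
  exists y^-1; first by rewrite invr_gt0.
  have yC : y%:C != 0 by rewrite -(rmorph0 toC) (inj_eq (@complexI _)) gt_eqF.
  rewrite fmorphV /=; apply: (mulfI yC); rewrite divff //.
  by apply/esym/eqP; rewrite -subr_eq0 e.
have nz : {in map toC ys, forall y, 1 - y * z != 0}.
  move: pz; rewrite /recip_prod horner_prod prodf_seq_neq0 => /allP h y /h /=.
  by rewrite !(hornerD, hornerN, hornerZ, hornerX, hornerC).
move: hz; rewrite rolle_op_horner // => /eqP; rewrite mulf_eq0 (negbTE pz) /= => /eqP.
case: z nz {pz} => u v nz hz.
have [v0|v0] := eqVneq v 0.
  exists u; last by rewrite v0.
  rewrite ltNge; apply/negP => u0.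
  move: hz; rewrite v0.
  have -> : \sum_(y <- map toC ys) y * (u +i* 0) / (1 - y * (u +i* 0)) =
     (\sum_(y <- ys) y * u / (1 - y * u))%:C.
    rewrite big_map raddf_sum; apply: eq_bigr => y _ /=.
    by rewrite !(rmorphM, fmorphV, rmorphB, rmorph1).
  rewrite -[u +i* 0]/(u%:C) -!rmorphM -!rmorphB -(rmorph0 toC) => /complexI.
  have := log_sum_le0 u0 hy.
  have : b * u <= 0 by rewrite mulr_ge0_le0.
  lra.
have [s [s0 sp hs]] := Im_log_sum u v0 hy.
move: (congr1 (@complex.Im R) hz); rewrite !ImB hs; simpc => /=.
rewrite ?mul0r ?addr0 ?add0r => e.
have bs : b + s = 0.
  by apply: (mulfI v0); rewrite mulr0; lra.
have bz : b = 0 by lra.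
have sz : s = 0 by lra.
have ys0 : ys = [::].
  by apply/eqP/negPn/negP => /sp; rewrite sz ltxx.
move: hz; rewrite ys0 bz big_nil mul0r !subr0 => /complexI az.
by rewrite az ltxx in a0.
Qed.

(** The polynomial splits over the complex numbers, and rolle_op_root_pos says that
    each of its roots is a positive real number. *)
Lemma recip_prod_rolle_op (a b : R) ys : 0 < a -> 0 <= b -> all_pos ys ->
  exists2 ys', all_pos ys' & rolle_op a b (recip_prod ys) = a *: recip_prod ys'.
Proof.
move=> a0 b0 hy; set q := rolle_op a b _.
have [rs hrs] := closed_field_poly_normal (map_poly toC q).
have qat0 : (map_poly toC q).[0] = a%:C.
  by rewrite -(rmorph0 toC) horner_map rolle_op_at0 recip_prod_at0 mulr1.
have lc0 : lead_coef (map_poly toC q) != 0.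
  rewrite lead_coef_eq0; apply: contraTneq a0 => e.
  by move: qat0; rewrite e horner0 => /esym /complexI ->; rewrite ltxx.
have hpos : {in rs, forall z, exists2 t, 0 < t & z = t%:C}.
  move=> z zrs; apply: (rolle_op_root_pos a0 b0 hy).
  by rewrite -/q hrs rootZ // root_prod_XsubC.
exists (map (fun z => (complex.Re z)^-1) rs).
  by move=> y /mapP[z /hpos[t t0 ->] ->]; rewrite invr_gt0.
apply: (map_inj_poly (@complexI R)) => //.
have [c hc] : exists c, map_poly toC q = c *: 
    recip_prod (map toC (map (fun z => (complex.Re z)^-1) rs)).
  rewrite hrs; move: (lead_coef _) => l.
  elim: rs hpos {hrs} => [|z rs IH] hpos.
    by exists l; rewrite big_nil recip_prod_nil.
  have [|c hc] := IH.
    by move=> x hx; apply: hpos; rewrite in_cons hx orbT.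
  have [t t0 zt] := hpos _ (mem_head _ _).
  exists (- z * c); rewrite big_cons !map_cons recip_prod_cons.
  rewrite scalerAr hc -scalerAr [- z * c]mulrC -scalerA; congr (_ *: _).
  rewrite zt /= scalerAl; congr (_ * _); rewrite scalerBr scalerA fmorphV mulNr divff; last first.
    by rewrite -(rmorph0 toC) (inj_eq (@complexI _)) gt_eqF.
  by rewrite scaleN1r opprK -alg_polyC scaleNr addrC.
rewrite hc map_polyZ recip_prod_map; congr (_ *: _).
by move: qat0; rewrite hc hornerZ recip_prod_at0 mulr1.
Qed.

End RealRoots.

(** * Laguerre polynomials and coefficientwise limits *)

Section Laguerre.
Local Open Scope classical_set_scope.
Variable R : realType.
Implicit Types (ys : seq R) (c : nat -> R).

Lemma coef_rolle_op a b (p : {poly R}) k :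
  (rolle_op a b p)`_k = (a + k%:R) * p`_k - b * (if k is j.+1 then p`_j else 0).
Proof.
rewrite /rolle_op coefD coefB !coefZ !coefXM; case: k => [|k] /=; first by ring.
rewrite coef_deriv -mulr_natr; ring.
Qed.

(** By induction on the degree: applying (b - x) + x d/dx to the polynomial of
    degree N with parameter b + 1 gives b times that of degree N + 1 with parameter b. *)
Lemma laguerre_recip_prod N (b : R) : 0 < b -> exists2 ys, all_pos ys &
  recip_prod ys = \poly_(k < N.+1) ((-1) ^+ k * 'C(N, k)%:R / rising b k).
Proof.
elim: N b => [|N IH] b b0.
  exists [::] => //; rewrite recip_prod_nil; apply/polyP => k.
  rewrite coef1 coef_poly; case: k => //=.
  by rewrite /rising big_ord0 expr0 bin0 invr1 !mulr1.
have b1 : 0 < b + 1 by lra.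
have [ys hy hys] := IH _ b1.
have [zs hz hzs] := recip_prod_rolle_op b0 ler01 hy.
exists zs => //; apply: (scalerI (lt0r_neq0 b0)); rewrite -hzs hys.
have r1 k : rising (b + 1) k != 0 by rewrite gt_eqF // rising_gt0.
have r0 k : rising b k != 0 by rewrite gt_eqF // rising_gt0.
apply/polyP => -[|k].
  rewrite coef_rolle_op coefZ !coef_poly /= !bin0 /rising !big_ord0.
  by rewrite !addr0 mulr0 subr0.
have bk : b + k.+1%:R != 0 by rewrite gt_eqF // addr_gt0.
have bk' : b + k%:R != 0 by rewrite gt_eqF // ltr_wpDr.
have e1 : rising (b + 1) k = rising b k * (b + k%:R) / b.
  by rewrite -risingS -(rising_shift b) mulfK // gt_eqF.
have e2 : rising (b + 1) k.+1 = rising b k * (b + k%:R) * (b + k.+1%:R) / b.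
  by rewrite -!risingS -(rising_shift b) mulfK // gt_eqF.
have nb : b != 0 by rewrite gt_eqF.
rewrite coef_rolle_op coefZ !coef_poly !ltnS.
have [kN|] := leqP k N; last first.
  by move=> Nk; rewrite [(k < N)%N]ltnNge ltnW //= !mulr0 subr0.
have -> : (if (k < N)%N then (-1) ^+ k.+1 * 'C(N, k.+1)%:R / rising (b + 1) k.+1
   else 0) = (-1) ^+ k.+1 * 'C(N, k.+1)%:R / rising (b + 1) k.+1 :> R.
  case: ifP => // /negbT; rewrite -leqNgt => Nk.
  by rewrite bin_small ?ltnS // mulr0 mul0r.
rewrite e1 e2 risingS binS natrD exprS.
field.
by rewrite bk' r0 nb [1 + _]addrC natr1 bk.
Qed.

Lemma recip_prod_dilate (s : R) ys k :
  (recip_prod (map (fun y => s * y) ys))`_k = s ^+ k * (recip_prod ys)`_k.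
Proof.
elim: ys k => [|y ys IH] k.
  by rewrite recip_prod_nil coef1; case: k => [|k] /=; rewrite ?expr0 ?mulr1 ?mulr0.
rewrite map_cons !recip_prod_cons !mulrBl !mul1r -!scalerAl !coefB !coefZ !coefXM.
case: k => [|k] /=; first by rewrite !mulr0 !subr0 IH.
rewrite !IH exprS; ring.
Qed.

(** A coefficientwise form of the Laguerre-Polya class with positive zeros. *)
Definition lp_limit c := exists ys : nat -> seq R,
  (forall N, all_pos (ys N)) /\
  forall k, (fun N => (recip_prod (ys N))`_k) @ \oo --> c k.

Lemma cvg_binomial_ratio k :
  (fun N : nat => 'C(N.+1, k)%:R / N.+1%:R ^+ k : R) @ \oo --> (k`!%:R^-1 : R).
Proof.
have h : (fun N : nat => (N.+1 ^_ k)%:R / N.+1%:R ^+ k : R) @ \oo --> (1 : R).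
  elim: k => [|k IH].
    rewrite (_ : (fun _ => _) = fun=> 1); first exact: cvg_cst.
    by apply/funext => N; rewrite ffactn0 expr0 divr1.
  have hk : (fun N : nat => (N.+1%:R - k%:R) / N.+1%:R : R) @ \oo --> (1 : R).
    rewrite (_ : (fun _ => _) = fun N : nat => 1 - k%:R * harmonic N :> R).
      rewrite -[X in _ --> X]subr0 -[X in _ - X](mulr0 k%:R).
      apply: cvgB; first exact: cvg_cst.
      by apply: cvgMr; exact: cvg_harmonic.
    apply/funext => N; rewrite /harmonic mulrBl divff //.
  rewrite -[X in _ --> X]mulr1.
  apply: cvg_trans (cvgM IH hk); apply: near_eq_cvg.
  near=> N.
  have kN : (k <= N.+1)%N by apply: leqW; near: N; exact: nbhs_infty_ge.
  rewrite /= ffactnSr natrM natrB // exprS.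
  have f0 : N.+1%:R != 0 :> R by rewrite pnatr_eq0.
  by rewrite mulrACA -invfM [N.+1%:R ^+ k * _]mulrC.
rewrite -[X in _ --> X]mul1r.
rewrite (_ : (fun _ => _) = fun N : nat => (N.+1 ^_ k)%:R / N.+1%:R ^+ k * k`!%:R^-1 :> R).
  by apply: cvgMl.
by apply/funext => N; rewrite -bin_ffact natrM mulrAC mulfK // pnatr_eq0 -lt0n fact_gt0.
Unshelve. all: by end_near.
Qed.

(** Laguerre polynomials in the variable x / (4N): the binomial coefficient divided
    by N^k tends to 1 / k!. *)
Lemma lp_limit_bessel (b : R) : 0 < b ->
  lp_limit (fun n => (-1) ^+ n / (4 ^+ n * n`!%:R * rising b n)).
Proof.
move=> b0.
have /choice[ys hys] : forall N, exists ys, all_pos ys /\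
    forall k, (recip_prod ys)`_k = (4 * N.+1%:R) ^- k *
      (\poly_(k < N.+2) ((-1) ^+ k * 'C(N.+1, k)%:R / rising b k))`_k.
  move=> N; have [ys hy e] := laguerre_recip_prod N.+1 b0.
  exists (map (fun y => (4 * N.+1%:R)^-1 * y) ys); split.
    by move=> y /mapP[x /hy x0 ->]; rewrite mulr_gt0 ?invr_gt0 ?mulr_gt0.
  by move=> k; rewrite recip_prod_dilate e exprVn.
exists ys; split=> [N|k]; first by have [] := hys N.
rewrite (_ : (-1) ^+ k / _ = (-1) ^+ k / 4 ^+ k / rising b k * k`!%:R^-1); last first.
  rewrite !invfM; ring.
have h := @cvg_binomial_ratio k.
apply: cvg_trans (cvgMl_tmp (a := (-1) ^+ k / 4 ^+ k / rising b k) h).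
apply: near_eq_cvg; near=> N.
have kN : (k < N.+2)%N by apply: leqW; apply: leqW; near: N; exact: nbhs_infty_ge.
rewrite /= (hys N).2 coef_poly kN exprMn invfM; ring.
Unshelve. all: by end_near.
Qed.

Lemma lp_limit_rolle_op (a : R) c : 0 < a -> lp_limit c ->
  lp_limit (fun n => (a + n%:R) / a * c n).
Proof.
move=> a0 [ys [hy hc]].
have /choice[zs hzs] : forall N, exists zs, all_pos zs /\
    rolle_op a 0 (recip_prod (ys N)) = a *: recip_prod zs.
  by move=> N; have [zs ? ?] := recip_prod_rolle_op a0 (lexx 0) (hy N); exists zs.
exists zs; split=> [N|k]; first by have [] := hzs N.
apply: cvg_trans (cvgMl_tmp (a := (a + k%:R) / a) (hc k)).
apply: near_eq_cvg; near=> N.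
have := congr1 (fun p : {poly R} => p`_k) (hzs N).2.
rewrite coef_rolle_op coefZ mul0r subr0 => e.
by rewrite /= mulrAC e mulrC mulKf // gt_eqF.
Unshelve. all: by end_near.
Qed.

End Laguerre.

(** * Power sums of positive numbers *)

Section PowerSums.
Local Open Scope classical_set_scope.
Variable R : rcfType.
Implicit Types (ys : seq R).

Definition psum ys (n : nat) : R := \sum_(y <- ys) y ^+ n.+1.

(** Newton's identities: modulo x^(n+1), the product of prod (1 - y x) by
    sum_k (sum_y y^(k+1)) x^k is minus its derivative, since each factor satisfies
    (1 - y x) sum_k (y x)^k = 1. *)
Lemma recip_prod_newton ys n :
  convol (nth 0 (recip_prod ys)) (psum ys) n =
  - (n.+1%:R * (recip_prod ys)`_n.+1).
Proof.
have [E hE] : exists E, recip_prod ys * \poly_(k < n.+1) psum ys k =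
    - (recip_prod ys)^`() + 'X^(n.+1) * E.
  elim: ys => [|y ys [E hE]].
    exists 0; rewrite recip_prod_nil mul1r mulr0 addr0 (_ : 1 = 1%:P) // derivC oppr0.
    by apply/polyP => k; rewrite coef_poly coef0 /psum big_nil if_same.
  have -> : \poly_(k < n.+1) psum (y :: ys) k =
      y *: \sum_(k < n.+1) (y *: 'X) ^+ k + \poly_(k < n.+1) psum ys k.
    rewrite !poly_def scaler_sumr -big_split /=; apply: eq_bigr => k _.
    by rewrite /psum big_cons scalerDl exprZn scalerA exprS.
  have geo : (1 - y *: 'X) * \sum_(k < n.+1) (y *: 'X) ^+ k =
      1 - y ^+ n.+1 *: 'X^(n.+1).
    by rewrite -exprZn mulr_geometric_sum.
  (* The remainder picks up the last term of the truncated geometric series. *)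
  exists ((1 - y *: 'X) * E - y *: (y ^+ n.+1 *: recip_prod ys)).
  rewrite recip_prod_cons derivM derivB derivZ derivX (_ : 1 = 1%:P) // derivC.
  move: geo hE; set S := \sum_(k < n.+1) _; set W := \poly_(k < n.+1) _.
  rewrite -!mul_polyC => geo hE.
  have -> : (1 - y%:P * 'X) * recip_prod ys * (y%:P * S + W) =
      y%:P * recip_prod ys * ((1 - y%:P * 'X) * S)
      + (1 - y%:P * 'X) * (recip_prod ys * W) by ring.
  by rewrite geo hE; ring.
have := congr1 (fun p : {poly R} => p`_n) hE.
rewrite coefD coefN coef_deriv coefXnM ltnSn addr0 mulr_natl => <-.
rewrite -convol_coef; apply: convol_eq => // i hi.
by rewrite coef_poly ltnS hi.
Qed.

(** The Cauchy-Schwarz inequality as a discriminant; in this form the hypothesis is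
    a family of closed inequalities and so survives passing to a limit. *)
Lemma sqr_le_of_quadratic (a b c : R) : 0 <= c ->
  (forall t, 0 <= a - 2 * t * b + t ^+ 2 * c) -> b ^+ 2 <= a * c.
Proof.
move=> c0 h; move: c0; rewrite le_eqVlt => /predU1P[ce|c0].
  have b0 : b = 0; last by rewrite b0 -ce expr0n /= mulr0.
  apply/eqP/negPn/negP => b0.
  (* When c = 0 the quadratic is affine in t; this t makes it equal to -1. *)
  have := h ((a + 1) / (2 * b)).
  have -> : 2 * ((a + 1) / (2 * b)) * b = a + 1 by field.
  by rewrite -ce mulr0; lra.
(* The minimum of the quadratic. *)
have := h (b / c).
rewrite -(pmulr_rge0 _ c0) => h1.
have e : c * (a - 2 * (b / c) * b + (b / c) ^+ 2 * c) = a * c - b ^+ 2.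
  by field; rewrite gt_eqF.
by move: h1; rewrite e subr_ge0.
Qed.

(** The 2 x 2 Hankel determinants, which measure how strict the log-convexity is. *)
Definition hankel2 (w : nat -> R) n := w n * w n.+2 - w n.+1 ^+ 2.

Lemma psum_ge0 ys n : all_pos ys -> 0 <= psum ys n.
Proof.
move=> hy; rewrite /psum big_seq; apply: sumr_ge0 => y /hy y0.
by rewrite exprn_ge0 // ltW.
Qed.

Lemma psum_submul ys i j : all_pos ys -> psum ys (i + j).+1 <= psum ys i * psum ys j.
Proof.
move=> hy; rewrite {2}/psum mulr_suml /psum big_seq [leRHS]big_seq.
apply: ler_sum => y yys; have y0 := hy _ yys.
rewrite -addnS -addSn exprD; apply: ler_wpM2l; first by rewrite exprn_ge0 // ltW.
rewrite (big_rem y) //= lerDl big_seq; apply: sumr_ge0 => x /mem_rem /hy x0.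
by rewrite exprn_ge0 // ltW.
Qed.

Lemma psum_quadratic ys n t : all_pos ys ->
  0 <= psum ys n.+2 - 2 * t * psum ys n.+1 + t ^+ 2 * psum ys n.
Proof.
move=> hy; have -> : psum ys n.+2 - 2 * t * psum ys n.+1 + t ^+ 2 * psum ys n
   = \sum_(y <- ys) y ^+ n.+1 * (y - t) ^+ 2.
  rewrite /psum !mulr_sumr -sumrB -big_split /=; apply: eq_bigr => y _.
  rewrite !exprS; ring.
rewrite big_seq; apply: sumr_ge0 => y /hy y0.
by rewrite mulr_ge0 ?sqr_ge0 // exprn_ge0 // ltW.
Qed.

(** Lagrange's identity: the Hankel determinants are themselves moments, of the
    products x y with the weights x y (x - y)^2, hence log-convex in turn. *)
Lemma psum_pairs ys n :
  2 * hankel2 (psum ys) n = \sum_(x <- ys) \sum_(y <- ys) (x * y) ^+ n.+1 * (x - y) ^+ 2.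
Proof.
have dist i j : psum ys i * psum ys j =
    \sum_(x <- ys) \sum_(y <- ys) x ^+ i.+1 * y ^+ j.+1.
  rewrite /psum mulr_suml; apply: eq_bigr => x _; by rewrite mulr_sumr.
have -> : 2 * hankel2 (psum ys) n = psum ys n * psum ys n.+2
    + psum ys n.+2 * psum ys n - 2 * (psum ys n.+1 * psum ys n.+1).
  rewrite /hankel2; ring.
rewrite !dist mulr_sumr -big_split /= -sumrB; apply: eq_bigr => x _.
rewrite mulr_sumr -big_split /= -sumrB; apply: eq_bigr => y _.
rewrite exprMn !exprS; ring.
Qed.

Lemma psum_hankel2_quadratic ys n t : all_pos ys ->
  0 <= hankel2 (psum ys) n.+2 - 2 * t * hankel2 (psum ys) n.+1
       + t ^+ 2 * hankel2 (psum ys) n.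
Proof.
move=> hy; rewrite -(pmulr_rge0 _ (@ltr0Sn R 1)).
have -> : 2 * (hankel2 (psum ys) n.+2 - 2 * t * hankel2 (psum ys) n.+1
       + t ^+ 2 * hankel2 (psum ys) n) = \sum_(x <- ys) \sum_(y <- ys)
         (x * y) ^+ n.+1 * (x - y) ^+ 2 * (x * y - t) ^+ 2.
  have -> : 2 * (hankel2 (psum ys) n.+2 - 2 * t * hankel2 (psum ys) n.+1
       + t ^+ 2 * hankel2 (psum ys) n) = 2 * hankel2 (psum ys) n.+2
       - 2 * t * (2 * hankel2 (psum ys) n.+1) + t ^+ 2 * (2 * hankel2 (psum ys) n) by ring.
  rewrite !psum_pairs !mulr_sumr -sumrB -big_split /=; apply: eq_bigr => x _.
  rewrite !mulr_sumr -sumrB -big_split /=; apply: eq_bigr => y _.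
  rewrite !exprS; ring.
rewrite big_seq; apply: sumr_ge0 => x /hy x0; rewrite big_seq.
apply: sumr_ge0 => y /hy y0.
apply: mulr_ge0; last exact: sqr_ge0; apply: mulr_ge0; last exact: sqr_ge0.
by rewrite exprn_ge0 // mulr_ge0 // ltW.
Qed.

End PowerSums.

(** * Growth of the limiting power sums *)

Section LimitPowerSums.
Local Open Scope classical_set_scope.
Variable R : realType.
Variables c w : nat -> R.
Hypothesis c_lp : lp_limit c.
Hypothesis c_0 : c 0%N = 1.
Hypothesis log_deriv_newton : forall n, convol c w n = - (n.+1%:R * c n.+1).

Lemma newton_solve (a u : nat -> R) n : a 0%N = 1 ->
  convol a u n = - (n.+1%:R * a n.+1) ->
  u n = - (n.+1%:R * a n.+1) - \sum_(i < n) a i.+1 * u (n - i.+1)%N.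
Proof.
move=> a0 <-; rewrite /convol big_ord_recl a0 mul1r subn0 /bump /=.
by rewrite addrK.
Qed.

Lemma cvg_sum_ord (f : nat -> nat -> R) (l : nat -> R) n :
  (forall i, (i < n)%N -> f i @ \oo --> l i) ->
  (fun N => \sum_(i < n) f i N) @ \oo --> \sum_(i < n) l i.
Proof.
elim: n => [|n IH] h.
  rewrite big_ord0 (_ : (fun _ => _) = fun=> 0); first exact: cvg_cst.
  by apply/funext => N; rewrite big_ord0.
rewrite big_ord_recr /=.
rewrite (_ : (fun _ => _) = fun N => \sum_(i < n) f i N + f n N); last first.
  by apply/funext => N; rewrite big_ord_recr.
by apply: cvgD; [apply: IH => i hi; apply: h; apply: ltnW|exact: h].
Qed.

(** Newton's identities determine the power sums from the coefficients by recursion,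
    so convergence of the coefficients carries over to the power sums. *)
Lemma psum_cvg : exists2 ys : nat -> seq R, (forall N, all_pos (ys N)) &
  forall n, (fun N => psum (ys N) n) @ \oo --> w n.
Proof.
have [ys [hy hc]] := c_lp; exists ys => // n.
elim/ltn_ind: n => n IH.
have p0 N : (recip_prod (ys N))`_0 = 1 by rewrite -horner_coef0 recip_prod_at0.
rewrite (newton_solve c_0 (log_deriv_newton n)).
rewrite (_ : (fun _ => _) = fun N => - (n.+1%:R * (recip_prod (ys N))`_n.+1) -
    \sum_(i < n) (recip_prod (ys N))`_i.+1 * psum (ys N) (n - i.+1)); last first.
  by apply/funext => N; apply: (@newton_solve (nth 0 (recip_prod (ys N))));
    [exact: p0|exact: recip_prod_newton].
apply: cvgB.
  by apply: cvgN; apply: cvgMr; exact: hc.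
apply: (@cvg_sum_ord (fun i N => (recip_prod (ys N))`_i.+1 * psum (ys N) (n - i.+1))
  (fun i => c i.+1 * w (n - i.+1)%N)).
move=> i hi; apply: cvgM; first exact: hc.
by apply: IH; rewrite ltn_subrL /= (leq_ltn_trans _ hi).
Qed.

Lemma hankel2_cvg (u : nat -> nat -> R) n : (forall n, u n @ \oo --> w n) ->
  (fun N => hankel2 (fun m => u m N) n) @ \oo --> hankel2 w n.
Proof.
move=> h; rewrite /hankel2; apply: cvgB; first by apply: cvgM; exact: h.
by rewrite expr2; under eq_fun do rewrite expr2; apply: cvgM; exact: h.
Qed.

Lemma w_ge0 n : 0 <= w n.
Proof.
have [ys hy hw] := psum_cvg; apply: (cvgr_to_ge (hw n)).
by near=> N; exact: psum_ge0.
Unshelve. all: by end_near. Qed.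

Lemma w_submul i j : w (i + j).+1 <= w i * w j.
Proof.
have [ys hy hw] := psum_cvg.
apply: (ler_cvg_to (hw _) (cvgM (hw i) (hw j))).
by near=> N; exact: psum_submul.
Unshelve. all: by end_near. Qed.

Lemma w_logconvex n : w n.+1 ^+ 2 <= w n.+2 * w n.
Proof.
have [ys hy hw] := psum_cvg; apply: sqr_le_of_quadratic; first exact: w_ge0.
move=> t; have h : (fun N => psum (ys N) n.+2 - 2 * t * psum (ys N) n.+1 + t ^+ 2 * psum (ys N) n)
    @ \oo --> w n.+2 - 2 * t * w n.+1 + t ^+ 2 * w n.
  apply: cvgD; last by apply: cvgMr; exact: hw.
  by apply: cvgB; [exact: hw|apply: cvgMr; exact: hw].
apply: (cvgr_to_ge h).
by near=> N; exact: psum_quadratic.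
Unshelve. all: by end_near. Qed.

Lemma w_hankel2_ge0 n : 0 <= hankel2 w n.
Proof. by rewrite subr_ge0 mulrC w_logconvex. Qed.

Lemma w_hankel2_logconvex n :
  hankel2 w n.+1 ^+ 2 <= hankel2 w n.+2 * hankel2 w n.
Proof.
have [ys hy hw] := psum_cvg; apply: sqr_le_of_quadratic; first exact: w_hankel2_ge0.
have hD m := @hankel2_cvg (fun n N => psum (ys N) n) m hw.
move=> t; have h : (fun N => hankel2 (psum (ys N)) n.+2 -
     2 * t * hankel2 (psum (ys N)) n.+1 + t ^+ 2 * hankel2 (psum (ys N)) n)
    @ \oo --> hankel2 w n.+2 - 2 * t * hankel2 w n.+1 + t ^+ 2 * hankel2 w n.
  apply: cvgD; last by apply: cvgMr; exact: hD.
  by apply: cvgB; [exact: hD|apply: cvgMr; exact: hD].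
apply: (cvgr_to_ge h).
by near=> N; exact: psum_hankel2_quadratic.
Unshelve. all: by end_near. Qed.

Hypothesis w0_gt0 : 0 < w 0%N.
Hypothesis w1_gt0 : 0 < w 1%N.

Lemma w_gt0 n : 0 < w n.
Proof.
suff: 0 < w n /\ 0 < w n.+1 by case.
elim: n => // n [h0 h1]; split=> //.
rewrite -(pmulr_lgt0 _ h0); apply: lt_le_trans (w_logconvex n).
by rewrite exprn_gt0.
Qed.

Definition ratio n := w n.+1 / w n.

Lemma ratio_le n : ratio n <= ratio n.+1.
Proof.
rewrite /ratio ler_pdivrMr ?w_gt0 // mulrAC ler_pdivlMr ?w_gt0 //.
by rewrite -expr2 w_logconvex.
Qed.

Lemma ratio_nondecreasing : nondecreasing_seq ratio.
Proof. by apply/nondecreasing_seqP; exact: ratio_le. Qed.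

Lemma ratio_is_cvg : cvgn ratio.
Proof.
apply: nondecreasing_is_cvgn; first exact: ratio_nondecreasing.
exists (w 0%N) => _ [n _ <-]; rewrite /ratio ler_pdivrMr ?w_gt0 //.
exact: (w_submul 0 n).
Qed.

Definition rate : R := limn ratio.

Lemma ratio_le_rate n : ratio n <= rate.
Proof. exact: nondecreasing_cvgn_le ratio_nondecreasing ratio_is_cvg n. Qed.

Lemma rate_gt0 : 0 < rate.
Proof. by apply: lt_le_trans (ratio_le_rate 0); rewrite divr_gt0 ?w_gt0. Qed.

Lemma w_rate n : w n.+1 <= rate * w n.
Proof. by rewrite -ler_pdivrMr ?w_gt0 //; exact: ratio_le_rate. Qed.

Lemma w_le_geometric n : w n <= w 0%N * rate ^+ n.
Proof.
elim: n => [|n IH]; first by rewrite mulr1.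
apply: (le_trans (w_rate n)); rewrite exprS mulrCA.
by rewrite ler_wpM2l // ltW ?rate_gt0.
Qed.

(** From ratio_m^(n+1) w_m <= w_(m+n+1) <= w_m w_n, by letting m tend to infinity. *)
Lemma rate_exp_le n : rate ^+ n.+1 <= w n.
Proof.
have ratio_exp m k : ratio m ^+ k * w m <= w (m + k)%N.
  elim: k => [|k IH]; first by rewrite expr0 mul1r addn0.
  have r0 : 0 <= ratio m by rewrite ltW // divr_gt0 ?w_gt0.
  rewrite exprS -mulrA addnS; apply: (le_trans (ler_wpM2l r0 IH)).
  rewrite -ler_pdivlMr ?w_gt0 //.
  by apply: ratio_nondecreasing; rewrite leq_addr.
have h : (fun m => ratio m ^+ n.+1) @ \oo --> rate ^+ n.+1.
  by apply: (@cvg_comp _ _ _ ratio (fun x => x ^+ n.+1) _ _ _ ratio_is_cvg);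
    exact: exprn_continuous.
apply: (cvgr_to_le h); near=> m.
rewrite -(ler_pM2r (w_gt0 m)); apply: (le_trans (ratio_exp _ _)).
by rewrite addnS mulrC w_submul.
Unshelve. all: by end_near. Qed.

Hypothesis hankel2_1 : 0 < hankel2 w 1.

(** A log-convex nonnegative sequence that is positive somewhere past its first term
    is positive everywhere. *)
Lemma w_hankel2_gt0 n : 0 < hankel2 w n.
Proof.
have h0 : 0 < hankel2 w 0.
  rewrite lt0r w_hankel2_ge0 andbT; apply: contraTneq (w_hankel2_logconvex 0) => ->.
  by rewrite mulr0 -ltNge exprn_gt0.
suff: 0 < hankel2 w n /\ 0 < hankel2 w n.+1 by case.
elim: n => // n [h1 h2]; split=> //.
rewrite -(pmulr_lgt0 _ h1); apply: lt_le_trans (w_hankel2_logconvex n).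
by rewrite exprn_gt0.
Qed.

Lemma w_lt_rate n : w n.+1 < rate * w n.
Proof.
rewrite -ltr_pdivrMr ?w_gt0 //; apply: lt_le_trans (ratio_le_rate n.+1).
rewrite ltr_pdivrMr ?w_gt0 // mulrAC ltr_pdivlMr ?w_gt0 //.
by rewrite -expr2 -subr_gt0 mulrC w_hankel2_gt0.
Qed.

(** If w_n were equal to L^(n+1), then w_(n+1) < L w_n would contradict
    L^(n+2) <= w_(n+1). *)
Lemma rate_exp_lt n : rate ^+ n.+1 < w n.
Proof.
rewrite -(ltr_pM2l rate_gt0) -exprS.
exact: le_lt_trans (rate_exp_le n.+1) (w_lt_rate n).
Qed.

End LimitPowerSums.

(** * Complex series with geometric majorants *)

Section ComplexSeries.
Local Open Scope classical_set_scope.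
Variable R : realType.
Implicit Types (u v : nat -> R[i]) (s z : R[i]).

Lemma complex_normE z : `|z| = (normc z)%:C.
Proof. by []. Qed.

Lemma normc_ge0 z : 0 <= normc z.
Proof. by case: z => a b; exact: sqrtr_ge0. Qed.

Lemma normcM (x y : R[i]) : normc (x * y) = normc x * normc y.
Proof. exact: ComplexField.Normc.normcM. Qed.

Lemma normcD (x y : R[i]) : normc (x + y) <= normc x + normc y.
Proof. exact: le_normcD. Qed.

Lemma normc_real (a : R) : normc a%:C = `|a|.
Proof. by rewrite /= expr0n /= addr0 sqrtr_sqr. Qed.

Lemma normcN z : normc (- z) = normc z.
Proof. exact: complex.normcN. Qed.

Lemma normcX z n : normc (z ^+ n) = normc z ^+ n.
Proof.
elim: n => [|n IH]; first by rewrite !expr0 (normc_real 1) normr1.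
by rewrite !exprS normcM IH.
Qed.

Lemma normc_eq0 z : normc z = 0 -> z = 0.
Proof. exact: ComplexField.Normc.eq0_normc. Qed.

Lemma normc_sum (I : Type) (r : seq I) (P : pred I) (F : I -> R[i]) :
  normc (\sum_(i <- r | P i) F i) <= \sum_(i <- r | P i) normc (F i).
Proof.
elim/big_ind2: _ => //; first by rewrite (normc_real 0) normr0.
by move=> x a y b h1 h2; apply: (le_trans (normcD _ _)); exact: lerD.
Qed.

Lemma normc_le_ReIm z : normc z <= `|complex.Re z| + `|complex.Im z|.
Proof.
rewrite {1}(complexE z); apply: (le_trans (normcD _ _)).
rewrite normcM !normc_real; have -> : normc 'i%C = 1 :> R.
  by rewrite /= expr0n expr1n /= add0r sqrtr1.
by rewrite mul1r.
Qed.

Lemma normc_ge_Re z : `|complex.Re z| <= normc z.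
Proof. by rewrite -lecR -complex_normE; exact: complex.normc_ge_Re. Qed.

Lemma normc_ge_Im z : `|complex.Im z| <= normc z.
Proof.
case: z => a b /=; rewrite -sqrtr_sqr ler_sqrt ?lerDr ?sqr_ge0 //.
by rewrite addr_ge0 ?sqr_ge0.
Qed.

(** The topology of R[i]^o is defined by a norm with values in R[i]; this returns to
    a statement about real sequences. *)
Lemma cvg_complexP (f : nat -> R[i]) s :
  ((f : nat -> R[i]^o) @ \oo --> (s : R[i]^o)) <->
  ((fun N => normc (s - f N)) @ \oo --> (0 : R)).
Proof.
split.
  move=> /cvgrPdist_lt h; apply/cvgrPdist_lt => e e0.
  have e0' : 0 < e%:C by rewrite ltcR.
  have := h _ e0'; apply: filterS => N.
  by move=> hN; rewrite sub0r normrN ger0_norm ?normc_ge0 // -ltcR.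
move=> /cvgrPdist_lt h; apply/cvgrPdist_lt => e e0.
have [r er] : exists r, e = r%:C.
  by exists (complex.Re e); rewrite RRe_real // gtr0_real.
rewrite er in e0 *; have r0 : 0 < r by rewrite -ltcR.
have := h _ r0; apply: filterS => N.
by rewrite sub0r normrN ger0_norm ?normc_ge0 // -ltcR.
Qed.

Definition hassum u s := series (u : nat -> R[i]^o) @ \oo --> (s : R[i]^o).

(** A geometric majorant is available for every series below, and unlike plain
    absolute convergence it is stable under polynomial weights and gives explicit
    tails. *)
Definition geo_bounded u :=
  exists M q, [/\ 0 <= q, q < 1 & forall n, normc (u n) <= M * q ^+ n].

Lemma hassum_cseries u s : hassum u s -> cseries u = s.
Proof. by move=> h; apply: cvg_lim h; exact: norm_hausdorff. Qed.

Lemma hassumD u v s t : hassum u s -> hassum v t ->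
  hassum (fun n => u n + v n) (s + t).
Proof.
move=> hu hv; rewrite /hassum (_ : series _ = series (u : nat -> R[i]^o) + series (v : nat -> R[i]^o)).
  exact: cvgD hu hv.
by rewrite -seriesD.
Qed.

Lemma hassumZ a u s : hassum u s -> hassum (fun n => a * u n) (a * s).
Proof.
move=> hu; rewrite /hassum (_ : series _ = (fun N => a *: (series u N : R[i]^o))).
  by apply: cvgZr; exact: hu.
by apply/funext => N; rewrite /series /= scaler_sumr.
Qed.

Lemma geo_majorant_cvg (f : nat -> R) M q : 0 <= q -> q < 1 ->
  (forall n, `|f n| <= M * q ^+ n) -> cvgn (series f).
Proof.
move=> q0 q1 h; apply: normed_cvg.
apply: (@series_le_cvg _ _ (geometric M q)).
- by move=> n; rewrite normr_ge0.
- by move=> n; apply: le_trans (h n); exact: normr_ge0.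
- exact: h.
- by apply: is_cvg_geometric_series; rewrite ger0_norm.
Qed.

(** Completeness of the real numbers is applied to the real and imaginary parts
    separately. *)
Lemma geo_bounded_hassum u : geo_bounded u -> hassum u (cseries u).
Proof.
move=> [M [q [q0 q1 hu]]].
have hr : cvgn (series (fun n => complex.Re (u n))).
  by apply: (geo_majorant_cvg q0 q1) => n; apply: le_trans (hu n); exact: normc_ge_Re.
have hi : cvgn (series (fun n => complex.Im (u n))).
  by apply: (geo_majorant_cvg q0 q1) => n; apply: le_trans (hu n); exact: normc_ge_Im.
set a := limn _ in hr; set b := limn _ in hi.
have h : hassum u (a +i* b); last by rewrite (hassum_cseries h).
have serE N : series (u : nat -> R[i]^o) N =
    series (fun n => complex.Re (u n)) N +i* series (fun n => complex.Im (u n)) N.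
  rewrite /series /=; elim: N => [|N IH]; first by rewrite !big_geq.
  by rewrite !big_nat_recr //= IH; case: (u N).
apply/cvg_complexP; apply: (@squeeze_cvgr _ _ _ _ (fun=> 0)
  (fun N => `|a - series (fun n => complex.Re (u n)) N| +
            `|b - series (fun n => complex.Im (u n)) N|)).
- near=> N; rewrite normc_ge0 /=; apply: (le_trans (normc_le_ReIm _)).
  by rewrite serE.
- exact: cvg_cst.
- have dist0 (f : nat -> R) l : f @ \oo --> l -> (fun N => `|l - f N|) @ \oo --> (0 : R).
    move=> hf; rewrite -[X in _ --> X](normr0 R) -[X in `|X|](subrr l).
    by apply: cvg_norm; apply: cvgB => //; exact: cvg_cst.
  by rewrite -[X in _ --> X]addr0; apply: cvgD; apply: dist0.
Unshelve. all: by end_near. Qed.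

Lemma hassum_real (f : nat -> R) (s : R) : series f @ \oo --> s ->
  hassum (fun n => (f n)%:C) s%:C.
Proof.
move=> /cvgrPdist_lt h; apply/cvg_complexP/cvgrPdist_lt => e e0.
have := h _ e0; apply: filterS => N hN.
rewrite sub0r normrN ger0_norm ?normc_ge0 //.
have -> : series (fun n => (f n)%:C : R[i]^o) N = (series f N)%:C.
  by rewrite /series /= rmorph_sum.
by rewrite -rmorphB normc_real.
Qed.

Lemma hassum_norm_le u s (f : nat -> R) t : hassum u s -> series f @ \oo --> t ->
  (forall n, normc (u n) <= f n) -> normc s <= t.
Proof.
move=> /cvg_complexP hu hf h.
have hg : (fun N => normc (s - series (u : nat -> R[i]^o) N) + series f N) @ \oo --> 0 + t.
  exact: cvgD.
rewrite add0r in hg; apply: (cvgr_to_ge hg); near=> N.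
rewrite -[s in normc s](subrK (series (u : nat -> R[i]^o) N)).
apply: (le_trans (normcD _ _)); rewrite lerD2l /series /=.
by apply: (le_trans (normc_sum _ _ _)); apply: ler_sum => i _.
Unshelve. all: by end_near. Qed.

Lemma hassum_geo_le u s M q : 0 <= q -> q < 1 -> hassum u s ->
  (forall n, normc (u n) <= M * q ^+ n) -> normc s <= M / (1 - q).
Proof.
move=> q0 q1 hu h; apply: (hassum_norm_le hu _ h).
by apply: cvg_geometric_series; rewrite ger0_norm.
Qed.

End ComplexSeries.

Section Geometric.
Local Open Scope classical_set_scope.
Variable R : realType.

(** Each of the n+1 terms of 1 + q + ... + q^n is at least q^n. *)
Lemma natmul_expr_le (q : R) n : 0 <= q -> q < 1 -> n.+1%:R * q ^+ n <= (1 - q)^-1.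
Proof.
move=> q0 q1; have q1' : 0 < 1 - q by lra.
rewrite -[leRHS]mul1r ler_pdivlMr //; apply: (@le_trans _ _ (1 - q ^+ n.+1)).
  have -> : 1 - q ^+ n.+1 = (\sum_(i < n.+1) q ^+ i) * (1 - q).
    by rewrite mulrC mulr_geometric_sum.
  rewrite ler_wpM2r ?(ltW q1') //.
  have -> : n.+1%:R * q ^+ n = \sum_(i < n.+1) q ^+ n.
    by rewrite sumr_const card_ord mulr_natl.
  by apply: ler_sum => i _; rewrite ler_wiXn2l ?(ltW q1) // -ltnS.
by rewrite gerBl exprn_ge0.
Qed.

Lemma geometric_weight (q : R) : 0 <= q -> q < 1 -> exists K p,
  [/\ 0 <= K, 0 <= p, p < 1 & forall n, n.+1%:R * q ^+ n <= K * p ^+ n].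
Proof.
(* Any p between q and 1 works: n (q/p)^n stays bounded. *)
move=> q0 q1; pose p := (1 + q) / 2; pose s := q / p.
have p0 : 0 < p by rewrite /p; lra.
have s0 : 0 <= s by rewrite divr_ge0 // ltW.
have s1 : s < 1 by rewrite ltr_pdivrMr // mul1r /p; lra.
exists (1 - s)^-1, p; split; [by rewrite invr_ge0; lra|exact: ltW|by rewrite /p; lra|].
move=> n; have -> : q = s * p by rewrite divfK // gt_eqF.
rewrite exprMn mulrA; apply: ler_wpM2r; first by rewrite exprn_ge0 // ltW.
exact: natmul_expr_le.
Qed.

Lemma geo_bounded_weight (u v : nat -> R[i]) : geo_bounded u ->
  (forall n, normc (v n) <= n.+1%:R * normc (u n)) -> geo_bounded v.
Proof.
move=> [M [q [q0 q1 hu]]] h.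
have [K [p [K0 p0 p1 hp]]] := geometric_weight q0 q1.
have M0 : 0 <= M by have := le_trans (normc_ge0 _) (hu 0%N); rewrite mulr1.
exists (M * K), p; split=> // n; apply: (le_trans (h n)).
apply: (@le_trans _ _ (M * (n.+1%:R * q ^+ n))).
  by rewrite mulrCA ler_wpM2l.
by rewrite -mulrA ler_wpM2l.
Qed.

Lemma geo_bounded_le (u v : nat -> R[i]) (B : R) : 0 <= B -> geo_bounded u ->
  (forall n, normc (v n) <= B * normc (u n)) -> geo_bounded v.
Proof.
move=> B0 [M [q [q0 q1 hu]]] h; exists (B * M), q; split=> // n.
by apply: (le_trans (h n)); rewrite -mulrA ler_wpM2l.
Qed.

Lemma hassum_tail (v : nat -> R[i]) s m : hassum v s ->
  hassum (fun n => v (n + m)%N) (s - series (v : nat -> R[i]^o) m).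
Proof.
move=> hv; rewrite /hassum (_ : series _ = fun N => series (v : nat -> R[i]^o) (N + m)%N - series (v : nat -> R[i]^o) m).
  apply: cvgB; last exact: cvg_cst.
  by move: hv; rewrite /hassum -(cvg_shiftn m).
apply/funext => N; rewrite /series /=.
rewrite [X in _ = X - _](@big_cat_nat _ _ _ m) ?leq_addl //= [RHS]addrC addKr.
by rewrite -{2}[m]add0n big_addn addnK.
Qed.

Lemma series_convol (u v : nat -> R[i]) N :
  \sum_(n < N) convol u v n = \sum_(i < N) u i * \sum_(j < N - i) v j.
Proof.
elim: N => [|N IH]; first by rewrite !big_ord0.
rewrite big_ord_recr /= IH big_ord_recr /= subSnn.
rewrite [X in X + _ = _](_ : _ = \sum_(i < N.+1) u i * \sum_(j < N - i) v j); last first.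
  by rewrite big_ord_recr /= subnn big_ord0 mulr0 addr0.
rewrite /convol -big_split /= [in LHS]big_ord_recr /=.
rewrite subnn big_ord0 mulr0 add0r big_ord1; congr (_ + _).
apply: eq_bigr => i _; rewrite -mulrDr subSn ?big_ord_recr //.
by rewrite ltnW.
Qed.

(** The N-th partial sum of the Cauchy product differs from the product of the sums by
    sum_i u_i r_(N-i), where the r_m are tails of v; geometric majorants bound this by
    a multiple of N q^N. *)
Lemma hassum_convol (u v : nat -> R[i]) : geo_bounded u -> geo_bounded v ->
  hassum (convol u v) (cseries u * cseries v).
Proof.
move=> gu gv; have hu := geo_bounded_hassum gu; have hv := geo_bounded_hassum gv.
move: gu gv => [M [q1 [q10 q11 bu]]] [M' [q2 [q20 q21 bv]]].
have [q [q0 q_1 q1q q2q]] : exists q, [/\ 0 <= q, q < 1, q1 <= q & q2 <= q].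
  by exists (Num.max q1 q2); rewrite le_max q10 gt_max q11 q21 !le_max !lexx orbT.
have M0 : 0 <= M by have := le_trans (normc_ge0 _) (bu 0%N); rewrite mulr1.
have M'0 : 0 <= M' by have := le_trans (normc_ge0 _) (bv 0%N); rewrite mulr1.
have {}bu n : normc (u n) <= M * q ^+ n.
  by apply: (le_trans (bu n)); rewrite ler_wpM2l // lerXn2r // nnegrE.
have {}bv n : normc (v n) <= M' * q ^+ n.
  by apply: (le_trans (bv n)); rewrite ler_wpM2l // lerXn2r // nnegrE.
have q1' : 0 < 1 - q by lra.
pose V := cseries v; pose r m := V - series (v : nat -> R[i]^o) m.
have tail m : normc (r m) <= M' * q ^+ m / (1 - q).
  have ht : hassum (fun n => v (n + m)%N) (r m) by exact: hassum_tail.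
  apply: (@hassum_geo_le _ _ (r m) (M' * q ^+ m) q q0 q_1 ht) => n.
  by rewrite -mulrA -exprD addnC.
rewrite /hassum (_ : series _ = fun N => series (u : nat -> R[i]^o) N * V
     - \sum_(i < N) u i * r (N - i)%N); last first.
  apply/funext => N; rewrite /series /= !big_mkord series_convol mulr_suml -sumrB.
  apply: eq_bigr => i _; rewrite /r /series /= big_mkord; ring.
have h1 : (fun N => series (u : nat -> R[i]^o) N * V : R[i]^o) @ \oo --> (cseries u * V : R[i]^o).
  rewrite mulrC (_ : (fun _ => _) = fun N => V *: (series (u : nat -> R[i]^o) N)).
    apply: cvgZr; exact: hu.
  by apply/funext => N; rewrite mulrC.
rewrite -[X in _ --> X]subr0; apply: cvgB; first exact: h1.
have [K [p [K0 p0 p1 hp]]] := geometric_weight q0 q_1.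
apply/cvg_complexP; apply: (@squeeze_cvgr _ _ _ _ (fun=> 0)
  (fun N => M * M' / (1 - q) * K * p ^+ N)).
- near=> N; rewrite normc_ge0 /= sub0r normcN.
  apply: (le_trans (normc_sum _ _ _)).
  apply: (@le_trans _ _ (\sum_(i < N) M * M' / (1 - q) * q ^+ N)).
    apply: ler_sum => i _; rewrite normcM.
    apply: (le_trans (ler_pM (normc_ge0 _) (normc_ge0 _) (bu i) (tail _))).
    have qN : q ^+ N = q ^+ i * q ^+ (N - i) by rewrite -exprD subnKC // ltnW.
    by rewrite le_eqVlt; apply/orP; left; apply/eqP; rewrite qN; ring.
  rewrite sumr_const card_ord -mulr_natl mulrCA -[leRHS]mulrA.
  apply: ler_wpM2l; first by rewrite divr_ge0 ?mulr_ge0 // ltW.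
  by apply: le_trans (hp N); rewrite ler_wpM2r ?exprn_ge0 // ler_nat.
- exact: cvg_cst.
- rewrite -[X in _ --> X](mulr0 (M * M' / (1 - q) * K)).
  by apply: cvgMr; apply: cvg_expr; rewrite ger0_norm.
Unshelve. all: by end_near. Qed.

End Geometric.

(** * Termwise differentiation *)

Section Derivative.
Local Open Scope classical_set_scope.
Variable R : realType.
Implicit Types (x y z h : R[i]) (t : R).

(** The factor t on the left replaces t^(n-1) by t^n on the right and avoids a case
    distinction at n = 0. *)
Lemma normc_expB t x y n : normc x <= t -> normc y <= t ->
  t * normc (x ^+ n - y ^+ n) <= n%:R * t ^+ n * normc (x - y).
Proof.
move=> xt yt; have t0 : 0 <= t by apply: le_trans xt; exact: normc_ge0.
elim: n => [|n IH]; first by rewrite !expr0 subrr (normc_real 0) normr0 mulr0 !mul0r.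
have -> : x ^+ n.+1 - y ^+ n.+1 = x * (x ^+ n - y ^+ n) + (x - y) * y ^+ n.
  by rewrite !exprS; ring.
apply: le_trans (ler_wpM2l t0 (normcD _ _)) _.
rewrite !normcM normcX mulrDr -natr1 !mulrDl mul1r; apply: lerD.
  rewrite mulrCA; apply: (le_trans (ler_wpM2l (normc_ge0 x) IH)).
  rewrite mulrA ler_wpM2r ?normc_ge0 // exprS mulrCA.
  by rewrite ler_wpM2l // ler_wpM2r // exprn_ge0.
rewrite exprS [leRHS]mulrC mulrCA ler_wpM2l ?normc_ge0 //.
by rewrite ler_wpM2l // lerXn2r // ?nnegrE // normc_ge0.
Qed.

Lemma normc_exp_taylor2 t x h n : normc x <= t -> normc (x + h) <= t ->
  t ^+ 2 * normc ((x + h) ^+ n - x ^+ n - n%:R * x ^+ n.-1 * h)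
    <= n%:R ^+ 2 * t ^+ n * normc h ^+ 2.
Proof.
move=> xt yt; have t0 : 0 <= t by apply: le_trans xt; exact: normc_ge0.
elim: n => [|n IH].
  by rewrite !expr0 subrr !mul0r subr0 (normc_real 0) normr0 mulr0 expr2 !mul0r.
have -> : (x + h) ^+ n.+1 - x ^+ n.+1 - n.+1%:R * x ^+ n.+1.-1 * h =
   (x + h) * ((x + h) ^+ n - x ^+ n - n%:R * x ^+ n.-1 * h)
   + n%:R * x ^+ n.-1 * h ^+ 2.
  by rewrite -natr1; case: n {IH} => [|n] /=; rewrite !exprS; ring.
apply: le_trans (ler_wpM2l (sqr_ge0 t) (normcD _ _)) _.
rewrite mulrDr !normcM !normcX.
have nn : normc (n%:R : R[i]) = n%:R.
  by rewrite -(rmorph_nat (real_complex R)) normc_real normr_nat.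
apply: (@le_trans _ _ (t * (n%:R ^+ 2 * t ^+ n * normc h ^+ 2) + n%:R * t ^+ n.+1 * normc h ^+ 2)).
  apply: lerD.
    rewrite mulrCA; apply: ler_pM => //; first exact: normc_ge0.
    by rewrite mulr_ge0 ?sqr_ge0 ?normc_ge0.
  rewrite nn (_ : t ^+ 2 * _ = t ^+ 2 * (n%:R * normc x ^+ n.-1) * normc h ^+ 2); last by ring.
  apply: ler_wpM2r; first exact: sqr_ge0.
  rewrite mulrCA; case: n {IH nn} => [|n] /=; first by rewrite !mul0r.
  apply: ler_wpM2l => //; rewrite (_ : t ^+ n.+2 = t ^+ 2 * t ^+ n); last by rewrite -exprD.
  apply: ler_wpM2l; first exact: sqr_ge0.
  by rewrite lerXn2r // ?nnegrE // normc_ge0.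
rewrite (exprS t n) -natr1.
have -> : (n%:R + 1) ^+ 2 * (t * t ^+ n) * normc h ^+ 2 =
  t * (n%:R ^+ 2 * t ^+ n * normc h ^+ 2) + n%:R * (t * t ^+ n) * normc h ^+ 2 +
  (n%:R + 1) * (t * t ^+ n) * normc h ^+ 2 by ring.
by rewrite lerDl mulr_ge0 ?sqr_ge0 // mulr_ge0 ?addr_ge0 ?ler0n // mulr_ge0 // exprn_ge0.
Qed.

(** An error of second order in h determines the derivative. *)
Lemma cderiv_quadratic (f : R[i] -> R[i]) z d B :
  (forall h, normc h <= 1 -> normc (f (z + h) - f z - d * h) <= B * normc h ^+ 2) ->
  cderiv f z = d.
Proof.
move=> H; rewrite /cderiv /derive1.
apply: (@cvg_lim R[i]^o); first exact: norm_hausdorff.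
apply/cvgrPdist_lt => e e0.
have [r er] : exists r, e = r%:C.
  by exists (complex.Re e); rewrite RRe_real // gtr0_real.
rewrite er in e0 *; have r0 : 0 < r by rewrite -ltcR.
have B0 : 0 <= B.
  have := H 1; rewrite (normc_real 1) normr1 => /(_ (lexx _)).
  by rewrite expr1n !mulr1 => hB; apply: le_trans hB; exact: normc_ge0.
have d0 : 0 < Num.min 1 (r / (B + 1)).
  by rewrite lt_min ltr01 divr_gt0 // ltr_wpDl.
near=> h.
have h0 : h != 0 by near: h; exact: nbhs_dnbhs_neq.
have hd : normc h < Num.min 1 (r / (B + 1)).
  rewrite -ltcR; near: h; apply: dnbhs0_lt; by rewrite ltcR.
move: hd; rewrite lt_min => /andP[h1 hr].
have nh0 : 0 < normc h.
  by rewrite lt0r normc_ge0 andbT; apply: contraNneq h0 => /normc_eq0 ->.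
have -> : d - h^-1 *: (f (h + z) - f z : R[i]^o) =
    - (h^-1 * (f (z + h) - f z - d * h)).
  rewrite addrC [h + z]addrC /GRing.scale /=.
  by field.
suff : normc (- (h^-1 * (f (z + h) - f z - d * h))) < r by rewrite -ltcR.
rewrite normcN normcM ComplexField.Normc.normcV.
rewrite mulrC ltr_pdivrMr //; apply: (le_lt_trans (H _ (ltW h1))).
rewrite expr2 mulrA ltr_pM2r //.
move: hr; rewrite ltr_pdivlMr ?ltr_wpDl // => hr.
apply: le_lt_trans hr; rewrite mulrC ler_wpM2l ?normc_ge0 // lerDl //.
Unshelve. all: by end_near. Qed.

End Derivative.

Section PowerSeries.
Local Open Scope classical_set_scope.
Variable R : realType.
Implicit Types (a b : nat -> R) (t : R) (x y z : R[i]).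

(** Arbitrary exponents m n are allowed so that the lemma applies both to the odd series
    of g and to the even series of its derivative. *)
Lemma cderiv_series a (m : nat -> nat) z t : normc z + 1 <= t ->
  geo_bounded (fun n => ((m n).+1%:R ^+ 2 * a n * t ^+ m n)%:C) ->
  cderiv (fun x => cseries (fun n => (a n)%:C * x ^+ m n)) z =
  cseries (fun n => (a n * (m n)%:R)%:C * z ^+ (m n).-1).
Proof.
move=> zt gb; have t1 : 1 <= t by have := normc_ge0 z; lra.
have t0 : 0 <= t by lra.
have bnd n : normc ((m n).+1%:R ^+ 2 * a n * t ^+ m n)%:C =
    (m n).+1%:R ^+ 2 * `|a n| * t ^+ m n.
  rewrite normc_real !normrM ger0_norm ?sqr_ge0 //.
  by rewrite (ger0_norm (exprn_ge0 _ t0)).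
have w1 n : 1 <= (m n).+1%:R ^+ 2 :> R by rewrite -natrX ler1n expn_gt0.
have sum_f x : normc x <= t -> geo_bounded (fun n => (a n)%:C * x ^+ m n).
  move=> xt; apply: (geo_bounded_le ler01 gb) => n.
  rewrite bnd mul1r normcM normcX normc_real -mulrA -[leLHS]mul1r.
  apply: ler_pM; rewrite ?mulr_ge0 ?exprn_ge0 ?normc_ge0 //.
  by rewrite ler_wpM2l // lerXn2r // ?nnegrE // normc_ge0.
have sum1 : geo_bounded (fun n => (a n * (m n)%:R)%:C * z ^+ (m n).-1).
  apply: (geo_bounded_le ler01 gb) => n.
  rewrite bnd mul1r normcM normcX normc_real normrM normr_nat.
  rewrite [`|a n| * _]mulrC; apply: ler_pM; rewrite ?mulr_ge0 ?exprn_ge0 ?normc_ge0 //.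
    by rewrite ler_wpM2r // -natrX ler_nat; nia.
  apply: (@le_trans _ _ (t ^+ (m n).-1)); last by rewrite ler_weXn2l // leq_pred.
  by rewrite lerXn2r // ?nnegrE ?normc_ge0 //; lra.
have [M [q [q0 q1 hq]]] := gb.
apply: (@cderiv_quadratic _ _ _ _ (M / (1 - q))) => h h1.
have zht : normc (z + h) <= t by have := normcD z h; lra.
have zt' : normc z <= t by lra.
have hs := hassumD (geo_bounded_hassum (sum_f _ zht)) (hassumD
  (hassumZ (a := -1) (geo_bounded_hassum (sum_f _ zt')))
  (hassumZ (a := - h) (geo_bounded_hassum sum1))).
rewrite [leRHS]mulrAC -[X in normc X]addrA -[X in _ + (X + _)]mulN1r [_ * h]mulrC -mulNr.
apply: (@hassum_geo_le _ _ _ _ q q0 q1 hs) => n.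
have -> : (a n)%:C * (z + h) ^+ m n + (-1 * ((a n)%:C * z ^+ m n) +
    - h * ((a n * (m n)%:R)%:C * z ^+ (m n).-1)) =
    (a n)%:C * ((z + h) ^+ m n - z ^+ m n - (m n)%:R * z ^+ (m n).-1 * h).
  by rewrite rmorphM /= rmorph_nat; ring.
rewrite normcM normc_real [leRHS]mulrAC.
have T := normc_exp_taylor2 (m n) zt' zht.
have T2 : normc ((z + h) ^+ m n - z ^+ m n - (m n)%:R * z ^+ (m n).-1 * h) <=
    (m n).+1%:R ^+ 2 * t ^+ m n * normc h ^+ 2.
  apply: (@le_trans _ _ ((m n)%:R ^+ 2 * t ^+ m n * normc h ^+ 2)).
    by apply: le_trans T; rewrite ler_peMl ?normc_ge0 // exprn_ege1.
  rewrite ler_wpM2r ?sqr_ge0 // ler_wpM2r ?exprn_ge0 //.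
  by rewrite lerXn2r ?nnegrE // ler_nat.
apply: (le_trans (ler_wpM2l (normr_ge0 _) T2)).
rewrite mulrA ler_wpM2r ?sqr_ge0 //; apply: le_trans (hq n).
by rewrite bnd mulrA [`|a n| * _]mulrC.
Qed.

Definition pterm a x (n : nat) : R[i] := (a n)%:C * x ^+ n.
Definition cps a x : R[i] := cseries (pterm a x).
Definition conv_at a t := geo_bounded (pterm a t%:C).
(** At a real point the sum is real, so taking the real part loses nothing
    (see rps_spec). *)
Definition rps a t : R := complex.Re (cps a t%:C).

Lemma normc_pterm a x n : normc (pterm a x n) = `|a n| * normc x ^+ n.
Proof. by rewrite normcM normcX normc_real. Qed.

Lemma conv_at_norm a t x : conv_at a t -> normc x <= t -> geo_bounded (pterm a x).
Proof.
move=> h xt; apply: (geo_bounded_le ler01 h) => n.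
have t0 : 0 <= t by apply: le_trans xt; exact: normc_ge0.
rewrite !normc_pterm mul1r normc_real (ger0_norm t0) ler_wpM2l //.
by rewrite lerXn2r // ?nnegrE // normc_ge0.
Qed.

Lemma cpsM a b x : conv_at a (normc x) -> conv_at b (normc x) ->
  cps a x * cps b x = cps (convol a b) x.
Proof.
move=> ha hb; have ga := conv_at_norm ha (lexx _).
have gb := conv_at_norm hb (lexx _).
rewrite -(hassum_cseries (hassum_convol ga gb)); congr cseries.
apply/funext => n; rewrite /convol /pterm rmorph_sum mulr_suml.
apply: eq_bigr => i _; rewrite rmorphM /=.
have -> : x ^+ n = x ^+ i * x ^+ (n - i).
  by rewrite -exprD subnKC //; have := ltn_ord i; rewrite ltnS.
ring.
Qed.

Lemma rps_spec a t : conv_at a `|t| ->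
  series (fun n => a n * t ^+ n) @ \oo --> rps a t /\ cps a t%:C = (rps a t)%:C.
Proof.
move=> h; have g : geo_bounded (pterm a t%:C).
  by apply: (conv_at_norm h); rewrite normc_real.
have [M [q [q0 q1 hq]]] := g.
have cv : cvgn (series (fun n => a n * t ^+ n)).
  apply: (geo_majorant_cvg q0 q1) => n; apply: le_trans (hq n).
  by rewrite normc_pterm normc_real normrM normrX.
have e : cps a t%:C = (limn (series (fun n => a n * t ^+ n)))%:C.
  apply: hassum_cseries; have := hassum_real cv.
  rewrite /hassum (_ : (fun n => (a n * t ^+ n)%:C) = pterm a t%:C) //.
  by apply/funext => n; rewrite /pterm rmorphM rmorphXn.
by rewrite /rps e.
Qed.

Lemma cps_norm_le a x : (forall n, 0 <= a n) -> conv_at a (normc x) ->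
  normc (cps a x) <= rps a (normc x).
Proof.
move=> a0 h; have h' : conv_at a `|normc x| by rewrite ger0_norm ?normc_ge0.
apply: (hassum_norm_le (geo_bounded_hassum (conv_at_norm h (lexx _))) (rps_spec h').1).
by move=> n; rewrite normc_pterm ger0_norm.
Qed.

Lemma rps_le a b s t : 0 <= s -> 0 <= t -> conv_at a s -> conv_at b t ->
  (forall n, a n * s ^+ n <= b n * t ^+ n) -> rps a s <= rps b t.
Proof.
move=> s0 t0 ha hb h.
have ha' : conv_at a `|s| by rewrite ger0_norm.
have hb' : conv_at b `|t| by rewrite ger0_norm.
apply: (ler_cvg_to (rps_spec ha').1 (rps_spec hb').1); near=> N.
by apply: ler_sum => i _.
Unshelve. all: by end_near. Qed.

(** A geometric lower bound of the coefficients forces the sum to blow up at 1 / L. *)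
Lemma rps_ge_geometric a L t : 0 <= L -> 0 <= t -> L * t < 1 -> conv_at a t ->
  (forall n, L ^+ n.+1 <= a n) -> L / (1 - L * t) <= rps a t.
Proof.
move=> L0 t0 Lt ha h; have ha' : conv_at a `|t| by rewrite ger0_norm.
have hg : series (geometric L (L * t)) @ \oo --> L / (1 - L * t).
  by apply: cvg_geometric_series; rewrite ger0_norm // mulr_ge0.
apply: (ler_cvg_to hg (rps_spec ha').1); near=> N.
apply: ler_sum => i _; rewrite /geometric /= exprMn mulrA -exprS.
by rewrite ler_wpM2r ?exprn_ge0.
Unshelve. all: by end_near. Qed.

Lemma hassum_first (u : nat -> R[i]) : (forall n, (0 < n)%N -> u n = 0) ->
  hassum u (u 0%N).
Proof.
move=> u0; apply/cvg_complexP; apply: cvg_near_cst; near=> N.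
have N0 : (0 < N)%N by near: N; exact: nbhs_infty_gt.
rewrite /series /= big_ltn // big1_seq ?addr0; last first.
  by move=> i /andP[_]; rewrite mem_index_iota => /andP[i0 _]; exact: u0.
by rewrite subrr (normc_real 0) normr0.
Unshelve. all: by end_near. Qed.

Lemma cps0 a : cps a 0 = (a 0%N)%:C.
Proof.
rewrite -[RHS]mulr1; apply: hassum_cseries; apply: hassum_first => n n0.
by rewrite /pterm expr0n gtn_eqF //= mulr0.
Qed.

Lemma cps_delta0 x : cps delta0 x = 1.
Proof.
rewrite -[RHS]mulr1; apply: hassum_cseries; apply: hassum_first => n n0.
by rewrite /pterm /delta0 gtn_eqF //= mul0r.
Qed.

Lemma cps_lipschitz a t : 0 < t -> conv_at a t -> exists2 K, 0 <= K &
  forall x y, normc x <= t -> normc y <= t ->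
    normc (cps a x - cps a y) <= K * normc (x - y).
Proof.
move=> t0 ha.
have [M [q [q0 q1 hq]]] : geo_bounded (pterm (fun n => n.+1%:R * a n) t%:C).
  apply: (geo_bounded_weight ha) => n.
  by rewrite !normc_pterm normrM normr_nat mulrA.
exists (M / t / (1 - q)) => [|x y xt yt].
  have := le_trans (normc_ge0 _) (hq 0%N); rewrite mulr1 => M0.
  by rewrite !divr_ge0 // ?subr_ge0 ltW.
have hx := geo_bounded_hassum (conv_at_norm ha xt).
have hy := geo_bounded_hassum (conv_at_norm ha yt).
have h := hassumD hx (hassumZ (a := -1) hy).
rewrite mulN1r in h.
have -> : M / t / (1 - q) * normc (x - y) = M / t * normc (x - y) / (1 - q) by ring.
apply: (@hassum_geo_le _ _ (cps a x - cps a y) _ q q0 q1 h) => n.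
have -> : pterm a x n + -1 * pterm a y n = (a n)%:C * (x ^+ n - y ^+ n).
  by rewrite /pterm; ring.
rewrite normcM normc_real -(ler_pM2l t0).
have -> : t * (M / t * normc (x - y) * q ^+ n) = M * q ^+ n * normc (x - y).
  by field; rewrite gt_eqF.
rewrite mulrCA; apply: (le_trans (ler_wpM2l (normr_ge0 _) (normc_expB n xt yt))).
rewrite mulrA ler_wpM2r ?normc_ge0 //; apply: le_trans (hq n).
rewrite normc_pterm normc_real (ger0_norm (ltW t0)) normrM normr_nat.
rewrite mulrA [`|a n| * _]mulrC !ler_wpM2r ?exprn_ge0 ?(ltW t0) //.
by rewrite ler_nat.
Qed.

Definition entire a := forall t, 0 <= t -> conv_at a t.

Lemma entire_dcoef a : entire a -> entire (dcoef a).
Proof.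
move=> ha t t0; have t1 : 0 <= t + 1 by lra.
have [M [q [q0 q1 hq]]] : geo_bounded (pterm (fun n => n.+1%:R * a n) (t + 1)%:C).
  apply: (geo_bounded_weight (ha _ t1)) => n.
  by rewrite !normc_pterm normrM normr_nat mulrA.
exists (M * q), q; split=> // n; rewrite -mulrA -exprS; apply: le_trans (hq n.+1).
rewrite !normc_pterm !normc_real (ger0_norm t0) (ger0_norm t1) /dcoef !normrM.
rewrite !normr_nat; apply: ler_pM; rewrite ?mulr_ge0 ?exprn_ge0 //.
  by rewrite ler_wpM2r // ler_nat.
apply: (@le_trans _ _ ((t + 1) ^+ n)); first by rewrite lerXn2r ?nnegrE //; lra.
by rewrite exprS ler_peMl ?exprn_ge0 //; lra.
Qed.

(** The finitely many terms before n0 are absorbed into the constant. *)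
Lemma eventually_geometric (u : nat -> R) (th : R) n0 : 0 < th ->
  (forall n, 0 <= u n) ->
  (forall K n, 0 <= K -> (n0 <= n)%N ->
     (forall j, (j < n)%N -> u j <= K * th ^+ j) -> u n <= K * th ^+ n) ->
  exists2 K, 0 <= K & forall n, u n <= K * th ^+ n.
Proof.
move=> th0 u0 h; exists (\sum_(j < n0) u j / th ^+ j).
  by apply: sumr_ge0 => j _; rewrite divr_ge0 ?exprn_ge0 // ltW.
move=> n; elim/ltn_ind: n => n IH; case: (leqP n0 n) => hn.
  apply: h => //.
  by apply: sumr_ge0 => j _; rewrite divr_ge0 ?exprn_ge0 // ltW.
rewrite -ler_pdivrMr ?exprn_gt0 // (bigD1 (Ordinal hn)) //= lerDl.
by apply: sumr_ge0 => j _; rewrite divr_ge0 ?exprn_ge0 // ltW.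
Qed.

End PowerSeries.

(** * The smallest zero *)

Section ZeroFreeDisc.
Local Open Scope classical_set_scope.
Variable R : realType.
Variables (c : nat -> R) (A L : R).
Hypothesis c_0 : c 0%N = 1.
Hypothesis c_entire : entire c.
Hypothesis L0 : 0 < L.
Hypothesis w_bound : forall n, `|neg_log_deriv c n| <= A * L ^+ n.

Lemma conv_at_log_deriv t : 0 <= t -> L * t < 1 -> conv_at (neg_log_deriv c) t.
Proof.
move=> t0 Lt; exists A, (L * t); split=> //; first by rewrite mulr_ge0 // ltW.
move=> n; rewrite normc_pterm normc_real (ger0_norm t0) exprMn mulrA.
by rewrite ler_wpM2r ?exprn_ge0.
Qed.

(** By induction in (n+1) h_(n+1) = sum_i w_i h_(n-i): if |h_j| <= K th^j for j <= n,
    the right-hand side is at most K th^(n+1) A / (th - L), and the factor n+1 on the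
    left wins as soon as n+1 >= A / (th - L). *)
Lemma inv_series_bound th : L < th ->
  exists2 K, 0 <= K & forall n, `|inv_series c n| <= K * th ^+ n.
Proof.
move=> Lth; have th0 : 0 < th by apply: lt_trans Lth.
have A0 : 0 <= A by have := le_trans (normr_ge0 _) (w_bound 0%N); rewrite mulr1.
have d0 : 0 < th - L by rewrite subr_gt0.
(* From this index on, n beats the constant of the recurrence. *)
pose n0 := (Num.truncn (A / (th - L))).+1.
apply: (@eventually_geometric _ _ _ n0 th0) => // K [|n] K0 hn hK.
  by rewrite ltn0 in hn.
have hA : A / (th - L) <= n.+1%:R.
  apply/ltW; apply: (@lt_le_trans _ _ n0%:R); last by rewrite ler_nat.
  by rewrite /n0 truncnS_gt.
have e : n.+1%:R * inv_series c n.+1 = convol (neg_log_deriv c) (inv_series c) n.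
  by rewrite -dcoef_inv_series.
have n1 : 0 < n.+1%:R :> R by [].
rewrite -(ler_pM2l n1) -{1}(ger0_norm (ltW n1)) -normrM e.
apply: (le_trans (ler_norm_sum _ _ _)).
pose s := L / th.
have s0 : 0 <= s by rewrite divr_ge0 ?ltW.
have s1 : s < 1 by rewrite ltr_pdivrMr // mul1r.
apply: (@le_trans _ _ (\sum_(i < n.+1) A * K * th ^+ n * s ^+ i)).
  apply: ler_sum => -[i hi] _ /=; rewrite normrM.
  apply: (le_trans (ler_pM (normr_ge0 _) (normr_ge0 _) (w_bound i) (hK (n - i)%N _))).
    by rewrite ltnS leq_subr.
  have -> : th ^+ n = th ^+ (n - i) * th ^+ i by rewrite -exprD subnK // -ltnS.
  rewrite /s expr_div_n le_eqVlt; apply/orP; left; apply/eqP.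
  by field; rewrite expf_neq0 // gt_eqF.
rewrite -mulr_sumr.
have geo : \sum_(i < n.+1) s ^+ i <= th / (th - L).
  have e1 : 1 - s = (th - L) / th by rewrite /s mulrBl divff // gt_eqF.
  have s1' : 0 < 1 - s by rewrite subr_gt0.
  rewrite -(ler_pM2l s1') mulr_geometric_sum e1.
  have -> : (th - L) / th * (th / (th - L)) = 1.
    by field; rewrite !gt_eqF.
  by rewrite gerBl exprn_ge0.
have AK : 0 <= A * K * th ^+ n by rewrite !mulr_ge0 // exprn_ge0 // ltW.
apply: (le_trans (ler_wpM2l AK geo)).
have -> : A * K * th ^+ n * (th / (th - L)) = A / (th - L) * (K * th ^+ n.+1).
  by rewrite exprS; field; rewrite gt_eqF.
by rewrite ler_wpM2r // mulr_ge0 // exprn_ge0 // ltW.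
Qed.

(** The series of 1/c converges at x, and its product with the series of c is 1. *)
Lemma cps_neq0 x : L * normc x < 1 -> cps c x != 0.
Proof.
move=> Lx; have x0 := normc_ge0 x.
have [th Lth thx] : exists2 th, L < th & th * normc x < 1.
  have [x00|x00] := eqVneq (normc x) 0; first by exists (L + 1); rewrite ?ltrDl // x00 mulr0.
  have xp : 0 < normc x by rewrite lt0r x00.
  exists ((L + (normc x)^-1) / 2).
    have : L < (normc x)^-1 by rewrite -[ltRHS]mul1r ltr_pdivlMr.
    lra.
  rewrite -ltr_pdivlMr // mul1r.
  have : L < (normc x)^-1 by rewrite -[ltRHS]mul1r ltr_pdivlMr.
  lra.
have [K K0 hK] := inv_series_bound Lth.
have hc : conv_at (inv_series c) (normc x).
  exists K, (th * normc x); split=> //; first by rewrite mulr_ge0 // ltW // (lt_trans L0).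
  move=> n; rewrite normc_pterm normc_real (ger0_norm x0) exprMn mulrA.
  by rewrite ler_wpM2r ?exprn_ge0.
have := cpsM (c_entire x0) hc; rewrite convol_inv_series //.
rewrite cps_delta0.
by move=> e; apply: contra_eq_neq e => ->; rewrite mul0r eq_sym oner_eq0.
Qed.

Lemma cps_log_deriv x : L * normc x < 1 ->
  cps c x * cps (neg_log_deriv c) x = - cps (dcoef c) x.
Proof.
move=> Lx; have x0 := normc_ge0 x.
rewrite (cpsM (c_entire x0) (conv_at_log_deriv x0 Lx)).
have hd := geo_bounded_hassum (conv_at_norm (entire_dcoef c_entire x0) (lexx _)).
rewrite -mulN1r; apply: hassum_cseries.
rewrite (_ : pterm _ x = fun n => -1 * pterm (dcoef c) x n); first exact: hassumZ hd.
by apply/funext => n; rewrite /pterm convol_log_deriv // [RHS]mulN1r rmorphN mulNr.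
Qed.

Lemma rps_log_deriv t : 0 <= t -> L * t < 1 ->
  rps c t * rps (neg_log_deriv c) t = - rps (dcoef c) t.
Proof.
move=> t0 Lt; have nt : normc t%:C = t by rewrite normc_real ger0_norm.
have := @cps_log_deriv t%:C; rewrite nt => /(_ Lt).
have nt' : `|t| = t by rewrite ger0_norm.
rewrite (rps_spec (t := t) _).2 ?nt'; last exact: c_entire.
rewrite (rps_spec (t := t) _).2 ?nt'; last exact: conv_at_log_deriv.
rewrite (rps_spec (t := t) _).2 ?nt'; last exact: entire_dcoef.
by rewrite -rmorphM -rmorphN => /complexI.
Qed.

Hypothesis w_ge : forall n, L ^+ n.+1 <= neg_log_deriv c n.

(** At distance d to the left of 1/L the logarithmic derivative is at least 1/d,
    hence |c| <= B d there, where B bounds |c'|; the Lipschitz property of c then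
    bounds |c(1/L)| by (K + B) d for every small d > 0. *)
Lemma cps_root : cps c L^-1%:C = 0.
Proof.
pose X := L^-1; have X0 : 0 < X by rewrite invr_gt0.
have XL : L * X = 1 by rewrite divff // gt_eqF.
have cX := c_entire (ltW X0); have dX := entire_dcoef c_entire (ltW X0).
have [K K0 hK] := cps_lipschitz X0 cX.
have [K' K'0 hK'] := cps_lipschitz X0 dX.
pose B := K' * X + `|dcoef c 0|.
have B0 : 0 <= B by rewrite addr_ge0 ?mulr_ge0 // ltW.
have hB t : 0 <= t -> t <= X -> `|rps (dcoef c) t| <= B.
  move=> t0 tX; have nt : normc t%:C = t by rewrite normc_real ger0_norm.
  rewrite -normc_real -(rps_spec (t := t) _).2; last first.
    by rewrite ger0_norm //; exact: entire_dcoef.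
  have := hK' t%:C 0; rewrite nt cps0 subr0 nt => /(_ tX).
  rewrite (normc_real 0) normr0 => /(_ (ltW X0)) h.
  rewrite -[cps _ _](subrK (dcoef c 0)%:C); apply: (le_trans (normcD _ _)).
  rewrite normc_real lerD2r; apply: (le_trans h); by rewrite ler_wpM2l.
apply: normc_eq0; apply/eqP; rewrite eq_le normc_ge0 andbT leNgt; apply/negP => pos.
(* If c(1/L) were nonzero, this distance would be small enough for a contradiction. *)
pose d := Num.min X (normc (cps c X%:C) / (K + B + 1) / 2).
have S0 : 0 < K + B + 1 by rewrite ltr_wpDl // addr_ge0.
have d0 : 0 < d by rewrite lt_min X0 !divr_gt0.
have dX' : d <= X by rewrite ge_min lexx.
pose t := X - d.
have t0 : 0 <= t by rewrite subr_ge0.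
have tX : t <= X by rewrite gerBl ltW.
have Lt : L * t < 1 by rewrite mulrBr XL ltrBlDr ltrDl mulr_gt0.
have nt : normc t%:C = t by rewrite normc_real ger0_norm.
have e := rps_log_deriv t0 Lt.
have Wge : d^-1 <= rps (neg_log_deriv c) t.
  apply: le_trans (rps_ge_geometric (ltW L0) t0 Lt (conv_at_log_deriv t0 Lt) w_ge).
  have -> : 1 - L * t = L * d by rewrite mulrBr XL opprB addrC subrK.
  by rewrite invfM mulrA divff ?mul1r // gt_eqF.
have hct : `|rps c t| <= B * d.
  have W0 : 0 < rps (neg_log_deriv c) t by apply: lt_le_trans Wge; rewrite invr_gt0.
  rewrite -ler_pdivrMr //; apply: (le_trans (ler_wpM2l (normr_ge0 _) Wge)).
  by rewrite -(ger0_norm (ltW W0)) -normrM e normrN hB.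
have hcX : normc (cps c X%:C) <= (K + B) * d.
  rewrite -[cps c _](subrK (cps c t%:C)); apply: (le_trans (normcD _ _)).
  rewrite mulrDl; apply: lerD.
    have := hK X%:C t%:C; rewrite -rmorphB nt !normc_real (ger0_norm (ltW X0)).
    move=> /(_ (lexx _) tX) h; apply: (le_trans h).
    by rewrite /t opprB addrC subrK ger0_norm // ltW.
  rewrite (rps_spec (t := t) _).2 ?normc_real //.
  by rewrite ger0_norm //; exact: c_entire.
have : (K + B) * d < normc (cps c X%:C).
  apply: (@le_lt_trans _ _ ((K + B + 1) * (normc (cps c X%:C) / (K + B + 1) / 2))).
    apply: ler_pM; [exact: addr_ge0|exact: ltW|by rewrite lerDl|].
    by rewrite /d ge_min lexx orbT.
  have -> : (K + B + 1) * (normc (cps c X%:C) / (K + B + 1) / 2) = normc (cps c X%:C) / 2.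
    by field; rewrite gt_eqF.
  by rewrite ltr_pdivrMr // ltr_pMr // ltr1n.
by rewrite ltNge hcX.
Qed.

End ZeroFreeDisc.

(** * Gauss's product for the gamma function *)

Section Gamma.
Local Open Scope classical_set_scope.
Variable R : realType.
Implicit Types (x y : R) (n : nat).

(** Young's inequality for the exponents 1/x and 1/(1-x). *)
Lemma powR_bernoulli x y : 0 < x -> x <= 1 -> -1 <= y -> (1 + y) `^ x <= 1 + x * y.
Proof.
move=> x0; rewrite le_eqVlt => /predU1P[->|x1] y1.
  by rewrite powRr1 ?mul1r //; lra.
have x1' : 0 < 1 - x by lra.
have := @conjugate_powR R ((1 + y) `^ x) 1 x^-1 (1 - x)^-1 (powR_ge0 _ _) ler01.
rewrite !invr_gt0 !invrK mulr1 powR1 -powRrM divff ?gt_eqF // powRr1; last by lra.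
move=> /(_ x0 x1' _) h.
have := h ltac:(ring); lra.
Qed.

Definition gauss_product x n : R := n`!%:R * n%:R `^ x / rising x n.+1.

(** For x <= 1 Bernoulli's inequality shows that the approximants increase, and that
    they decrease when n^x is replaced by (n+1)^x; the latter bounds them from above. *)
Lemma gauss_product_small x : 0 < x -> x <= 1 ->
  exists2 l : R, 0 < l & gauss_product x @ \oo --> l.
Proof.
move=> x0 x1.
have r0 n : 0 < rising x n by exact: rising_gt0.
have cancel_r (F N P r s : R) : 0 < r -> 0 < s ->
    r * (N * F * P / (r * s)) = F * (N * P / s).
  by move=> rp sp; field; rewrite !gt_eqF.
have nd : nondecreasing_seq (fun n => gauss_product x n.+1).
  apply/nondecreasing_seqP => n.
  rewrite /gauss_product (risingS _ n.+2) (factS n.+1) natrM.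
  set r := rising x n.+2; have rp : 0 < r by exact: r0.
  have xn : 0 < x + n.+2%:R by rewrite addr_gt0.
  have n2 : 0 < n.+2%:R :> R by [].
  have key : n.+1%:R `^ x * (x + n.+2%:R) <= n.+2%:R * n.+2%:R `^ x :> R.
    have -> : n.+1%:R = n.+2%:R * (1 + - n.+2%:R^-1) :> R.
      by rewrite mulrDr mulr1 mulrN divff ?gt_eqF // -[n.+2%:R]natr1 addrK.
    have i1 : n.+2%:R^-1 <= 1 :> R by rewrite invf_le1 // ler1n.
    rewrite powRM ?ler0n //; last by rewrite subr_ge0.
    rewrite -mulrA mulrC; apply: ler_wpM2r; first exact: powR_ge0.
    have b : (1 + - n.+2%:R^-1) `^ x <= 1 + x * - n.+2%:R^-1.
      by apply: powR_bernoulli => //; rewrite lerN2.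
    apply: (le_trans (ler_wpM2r (ltW xn) b)).
    have -> : (1 + x * - n.+2%:R^-1) * (x + n.+2%:R) = n.+2%:R - x ^+ 2 / n.+2%:R.
      by field; rewrite ?gt_eqF //; rewrite -natr1 in n2; rewrite ?gt_eqF.
    by rewrite gerBl divr_ge0 ?sqr_ge0 // ltW.
  rewrite ler_pdivrMr // [leRHS]mulrC.
  by rewrite cancel_r // ler_wpM2l // ler_pdivlMr.
(* With (n+1)^x in place of n^x the approximants decrease, from at most 1/x at n = 1. *)
have ni n : n.+1`!%:R * n.+2%:R `^ x / rising x n.+2 <= x^-1.
  elim: n => [|n IH].
    rewrite ler_pdivrMr // risingS rising1 mul1r mulKf ?gt_eqF // addrC.
    have := @powR_bernoulli x 1 x0 x1; rewrite mulr1; apply; lra.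
  apply: le_trans IH; rewrite (risingS _ n.+2) (factS n.+1) natrM.
  set r := rising x n.+2; have rp : 0 < r by exact: r0.
  have xn : 0 < x + n.+2%:R by rewrite addr_gt0.
  have n2 : 0 < n.+2%:R :> R by [].
  have key : n.+2%:R * n.+3%:R `^ x <= n.+2%:R `^ x * (x + n.+2%:R) :> R.
    have -> : n.+3%:R = n.+2%:R * (1 + n.+2%:R^-1) :> R.
      by rewrite mulrDr mulr1 divff ?gt_eqF // -[n.+3%:R]natr1.
    rewrite powRM ?ler0n ?addr_ge0 ?invr_ge0 //.
    rewrite mulrCA; apply: ler_wpM2l; first exact: powR_ge0.
    have i0 : 0 <= n.+2%:R^-1 :> R by rewrite invr_ge0.
    have b : (1 + n.+2%:R^-1) `^ x <= 1 + x * n.+2%:R^-1.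
      by apply: powR_bernoulli => //; apply: le_trans i0; rewrite oppr_le0.
    apply: (le_trans (ler_wpM2l (ltW n2) b)).
    by rewrite mulrDr mulrCA divff ?gt_eqF // !mulr1 addrC.
  rewrite ler_pdivlMr // mulrC cancel_r //.
  by rewrite ler_wpM2l // ler_pdivrMr.
have ub : has_ubound (range (fun n => gauss_product x n.+1)).
  exists x^-1 => _ [n _ <-]; apply: le_trans (ni n).
  apply: ler_wpM2r; first by rewrite invr_ge0 ltW.
  apply: ler_wpM2l; first exact: ler0n.
  by rewrite ge0_ler_powR ?nnegrE ?ler_nat // ltW.
have cv := nondecreasing_is_cvgn nd ub.
exists (limn (fun n => gauss_product x n.+1)); last by move: cv; rewrite cvg_shiftS.
apply: lt_le_trans (nondecreasing_cvgn_le nd cv 0).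
by rewrite /gauss_product divr_gt0 // mulr_gt0 ?powR_gt0 // ltr0n fact_gt0.
Qed.

Lemma gauss_product_shift x (l : R) : 0 < x -> gauss_product x @ \oo --> l -> gauss_product (x + 1) @ \oo --> x * l.
Proof.
move=> x0 h.
have h1 : (fun n : nat => n%:R / (x + n.+1%:R) : R) @ \oo --> (1 : R).
  have x1 : 0 <= x + 1 by lra.
  have h0 : (fun n : nat => (x + 1) / (x + n.+1%:R) : R) @ \oo --> (0 : R).
    apply: (@squeeze_cvgr _ _ _ _ (fun=> 0) (fun n => (x + 1) * harmonic n)).
    - near=> n; rewrite divr_ge0 ?addr_ge0 ?(ltW x0) //=.
      rewrite /harmonic ler_wpM2l // lef_pV2 ?posrE ?addr_gt0 //.
      by rewrite lerDr ltW.
    - exact: cvg_cst.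
    - rewrite -[X in _ --> X](mulr0 (x + 1)).
      by apply: cvgMr; exact: cvg_harmonic.
  rewrite (_ : (fun _ => _) = fun n : nat => 1 - (x + 1) / (x + n.+1%:R)).
    rewrite -[X in _ --> X]subr0; apply: cvgB => //; exact: cvg_cst.
  apply/funext => n; have xn : x + n.+1%:R != 0 by rewrite gt_eqF // addr_gt0.
  apply: (mulIf xn); rewrite mulrBl !divfK // mul1r -natr1; ring.
have h2 : (fun n : nat => gauss_product x n * (n%:R / (x + n.+1%:R)) * x) @ \oo --> x * l.
  rewrite (_ : x * l = l * 1 * x); last by ring.
  by apply: cvgM; [apply: cvgM; [exact: h|exact: h1]|exact: cvg_cst].
apply: cvg_trans h2; apply: near_eq_cvg; near=> n.
have n0 : (0 < n)%N by near: n; exact: nbhs_infty_gt.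
have nR : n%:R != 0 :> R by rewrite pnatr_eq0 -lt0n.
have r0 := rising_gt0 n.+1 x0; have xn : 0 < x + n.+1%:R by rewrite addr_gt0.
rewrite /gauss_product powRD ?nR ?implybT // powRr1 //=.
have -> : rising (x + 1) n.+1 = rising x n.+1 * (x + n.+1%:R) / x.
  by rewrite -risingS -(rising_shift x) mulfK // gt_eqF.
move: (x + n.+1%:R) (rising x n.+1) xn r0 => s r s0 r0.
by field; rewrite !gt_eqF.
Unshelve. all: by end_near. Qed.

Lemma gauss_product_cvg x : 0 < x -> exists2 l : R, 0 < l & gauss_product x @ \oo --> l.
Proof.
suff h k : forall x, 0 < x -> x <= k.+1%:R -> exists2 l : R, 0 < l & gauss_product x @ \oo --> l.
  move=> x0; apply: (h (Num.truncn x)) => //.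
  by apply/ltW; exact: truncnS_gt.
elim: k => [|k IH] y y0 yk; first exact: gauss_product_small.
have [y1|y1] := leP y 1; first exact: gauss_product_small.
have [||l l0 hl] := IH (y - 1); first by lra.
  by rewrite lerBlDr natr1.
have y10 : 0 < y - 1 by lra.
exists ((y - 1) * l); first by rewrite mulr_gt0.
by have := gauss_product_shift y10 hl; rewrite subrK.
Qed.

Lemma gamma_gt0 x : 0 < x -> 0 < gamma x.
Proof.
move=> x0; have [l l0 hl] := gauss_product_cvg x0.
by rewrite /gamma (cvg_lim _ hl).
Qed.

Lemma gammaD1 x : 0 < x -> gamma (x + 1) = x * gamma x.
Proof.
move=> x0; have [l l0 hl] := gauss_product_cvg x0.
by rewrite /gamma (cvg_lim _ hl) // (cvg_lim _ (gauss_product_shift x0 hl)).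
Qed.

Lemma gammaDn x n : 0 < x -> gamma (x + n%:R) = rising x n * gamma x.
Proof.
move=> x0; elim: n => [|n IH]; first by rewrite addr0 /rising big_ord0 mul1r.
by rewrite -natr1 addrA gammaD1 ?ltr_wpDr // IH risingS mulrA [_ * (x + _)]mulrC.
Qed.

End Gamma.

(** * The Bessel series *)

Section BesselSeries.
Local Open Scope classical_set_scope.
Variable R : realType.
Implicit Types (a : nat -> R) (b t : R) (z : R[i]).

Definition bcoef b n : R := (-1) ^+ n / (4 ^+ n * n`!%:R * rising b n).

Lemma bcoefS b n : 0 < b ->
  bcoef b n.+1 = - (bcoef b n / (4 * n.+1%:R * (b + n%:R))).
Proof.
move=> b0; rewrite /bcoef !exprS factS natrM risingS.
have r0 := rising_gt0 n b0; have bn : 0 < b + n%:R by rewrite ltr_wpDr.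
have f0 : 0 < n`!%:R :> R by rewrite ltr0n fact_gt0.
have n0 : 0 < n.+1%:R :> R by [].
have p0 : 0 < 4 ^+ n :> R by rewrite exprn_gt0.
move: (b + _) (rising _ _) n`!%:R n.+1%:R (4 ^+ n) bn r0 f0 n0 p0 => s r f m p *.
by field; rewrite !gt_eqF.
Qed.

(** Consecutive terms have ratio t / (4 (n+1) (b+n)), which is eventually below 1/2. *)
Lemma entire_bcoef b : 0 < b -> entire (bcoef b).
Proof.
move=> b0 t t0; pose u n := `|bcoef b n| * t ^+ n.
have h2 : 0 < 2^-1 :> R by rewrite invr_gt0.
have [K K0 hK] : exists2 K, 0 <= K & forall n, u n <= K * 2^-1 ^+ n.
  apply: (@eventually_geometric _ u _ (Num.truncn t).+2 h2) => [n|K [|n] K0 hn hu].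
  - by rewrite /u mulr_ge0 ?exprn_ge0.
  - by [].
  rewrite ltnS in hn; have nt : t <= n.+1%:R.
    by apply/ltW/(lt_le_trans (truncnS_gt t)); rewrite ler_nat ltnW.
  have bn : 1 <= b + n%:R.
    have : 1 <= n%:R :> R by rewrite ler1n (leq_ltn_trans _ hn).
    lra.
  have n0 : 0 < n.+1%:R :> R by [].
  have d0 : 0 < 4 * n.+1%:R * (b + n%:R) by rewrite !mulr_gt0 //; lra.
  have -> : u n.+1 = u n * (t / (4 * n.+1%:R * (b + n%:R))).
    rewrite /u bcoefS // normrN normrM normfV (ger0_norm (ltW d0)) exprS; ring.
  rewrite exprSr [leRHS]mulrA; apply: ler_pM.
  - by rewrite /u mulr_ge0 ?exprn_ge0.
  - by rewrite divr_ge0 // ltW.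
  - exact: hu.
  rewrite ler_pdivrMr //; nra.
exists K, 2^-1; split; [by rewrite ltW|by lra|] => n.
by rewrite normc_pterm normc_real (ger0_norm t0); exact: hK.
Qed.

Lemma entire_affine a (p : R) : 0 < p -> entire a ->
  entire (fun n => (p + n%:R) / p * a n).
Proof.
move=> p0 ha t t0.
have h : geo_bounded (pterm (fun n => n.+1%:R * a n) t%:C).
  apply: (geo_bounded_weight (ha _ t0)) => n.
  by rewrite !normc_pterm normrM normr_nat mulrA.
have B0 : 0 <= 1 + p^-1 by rewrite addr_ge0 // invr_ge0 ltW.
apply: (geo_bounded_le B0 h) => n.
have pn : 0 <= (p + n%:R) / p by rewrite divr_ge0 ?addr_ge0 // ltW.
rewrite !normc_pterm (normrM _ (a n)) (normrM n.+1%:R) (ger0_norm pn) normr_nat mulrA mulrA.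
rewrite ler_wpM2r ?exprn_ge0 ?normc_ge0 // ler_wpM2r //.
rewrite ler_pdivrMr //.
have -> : (1 + p^-1) * n.+1%:R * p = (1 + p) * n.+1%:R by field; rewrite gt_eqF.
rewrite -natr1; have : 0 <= n%:R :> R by []. 
nra.
Qed.

Lemma g_power_series nu z : -1 < nu -> g nu z = z * cps (bcoef (nu + 1)) (z ^+ 2).
Proof.
move=> hnu; have b0 := nu1_gt0 hnu.
have h := geo_bounded_hassum (conv_at_norm (entire_bcoef b0 (normc_ge0 (z ^+ 2))) (lexx _)).
apply: hassum_cseries.
rewrite (_ : (fun _ => _) = fun n => z * pterm (bcoef (nu + 1)) (z ^+ 2) n).
  exact: hassumZ h.
by apply/funext => n; rewrite /pterm -exprM exprD expr1 mulrA [RHS]mulrC.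
Qed.

Definition cis t : R[i] := cos t +i* sin t.

Lemma cisD s t : cis (s + t) = cis s * cis t.
Proof. by rewrite /cis cosD sinD; simpc; congr (_ +i* _); ring. Qed.

Lemma cis_mulrn t n : cis (n%:R * t) = cis t ^+ n.
Proof.
elim: n => [|n IH]; first by rewrite mul0r /cis cos0 sin0 expr0.
by rewrite -natr1 mulrDl mul1r cisD IH exprSr.
Qed.

Lemma cis_carg z : z != 0 -> (normc z)%:C * cis (carg z) = z.
Proof.
case: z => x y z0; have n0 : 0 < normc (x +i* y).
  by rewrite lt0r normc_ge0 andbT; apply: contraNneq z0 => /normc_eq0 ->.
have ne : normc (x +i* y) ^+ 2 = x ^+ 2 + y ^+ 2.
  by rewrite /= sqr_sqrtr // addr_ge0 ?sqr_ge0.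
rewrite /cis /carg; move: (normc _) n0 ne => r r0 re /=.
have xr : (x / r) ^+ 2 <= 1.
  by rewrite expr_div_n ler_pdivrMr ?exprn_gt0 // mul1r re lerDl sqr_ge0.
have xr1 : -1 <= x / r <= 1 by rewrite -ler_norml -(@expr_le1 _ 2) // real_normK ?num_real.
have cE : cos (if 0 <= y then acos (x / r) else - acos (x / r)) = x / r.
  by case: ifP => _; rewrite ?cosN acosK // in_itv.
have sE : sin (if 0 <= y then acos (x / r) else - acos (x / r)) = y / r.
  have -> : y / r = if 0 <= y then `|y / r| else - `|y / r|.
    rewrite normrM normfV (gtr0_norm r0); case: ifP => [y0|/negbT].
      by rewrite ger0_norm.
    by rewrite -ltNge => y0; rewrite ltr0_norm // mulNr opprK.
  have s : sin (acos (x / r)) = `|y / r|.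
    rewrite sin_acos // -sqrtr_sqr; congr Num.sqrt.
    by rewrite !expr_div_n re; field; rewrite -re expf_neq0 // gt_eqF.
  by case: ifP => _; rewrite ?sinN s.
rewrite cE sE; simpc; congr (_ +i* _); by rewrite mulrC divfK // gt_eqF.
Qed.

Lemma half_real : 2^-1 = (2^-1)%:C :> R[i].
Proof. by rewrite fmorphV rmorph_nat. Qed.

Lemma cis_neq0 t : cis t != 0.
Proof.
apply/negP => /eqP e; have := cisD t (- t).
rewrite subrr e mul0r /cis cos0 sin0 => /eqP.
by rewrite eq_complex /= oner_eq0.
Qed.

Lemma carg_half z : carg (z / 2) = carg z.
Proof.
case: z => x y; have -> : (x +i* y) / 2 = (x / 2) +i* (y / 2).
  by rewrite half_real; simpc.
have -> : (x / 2) +i* (y / 2) = (x +i* y) * (2^-1)%:C by simpc.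
rewrite /carg normcM normc_real (@ger0_norm _ 2^-1) ?invr_ge0 //.
simpc => /=; rewrite pmulr_lge0 ?invr_gt0 // invfM invrK.
by rewrite mulrACA mulVf ?mulr1.
Qed.

(** The arguments (1 - nu) th and (2n + nu) th add up to (2n+1) th, so the branch of the
    two powers is irrelevant for their product. *)
Lemma cpow_mul nu n z : z != 0 ->
  (2 `^ nu)%:C * cpow z (1 - nu) * cpow (z / 2) ((2 * n)%:R + nu) =
  (4 ^- n)%:C * z ^+ (2 * n + 1).
Proof.
move=> z0; have n0 : 0 < normc z.
  by rewrite lt0r normc_ge0 andbT; apply: contraNneq z0 => /normc_eq0 ->.
have n0' : normc z != 0 by rewrite gt_eqF.
rewrite /cpow carg_half -!/(cis _) normcM.
have -> : normc (2^-1 : R[i]) = 2^-1.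
  by rewrite half_real normc_real ger0_norm // invr_ge0.
transitivity ((2 `^ nu * normc z `^ (1 - nu) * (normc z * 2^-1) `^ ((2 * n)%:R + nu))%:C
   * (cis ((1 - nu) * carg z) * cis (((2 * n)%:R + nu) * carg z))).
  rewrite !rmorphM /=; ring.
rewrite -cisD -mulrDl.
have -> : 1 - nu + ((2 * n)%:R + nu) = (2 * n + 1)%:R by rewrite natrD; ring.
rewrite cis_mulrn.
have -> : 2 `^ nu * normc z `^ (1 - nu) * (normc z * 2^-1) `^ ((2 * n)%:R + nu)
    = 4 ^- n * normc z ^+ (2 * n + 1).
  rewrite powRM ?invr_ge0 //; last exact: ltW.
  have -> : 2^-1 `^ ((2 * n)%:R + nu) = 2 `^ (- (2 * n)%:R) * 2 `^ (- nu) :> R.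
    rewrite -[2^-1](@powR_inv1 R 2) // -powRrM -powRD; last by rewrite pnatr_eq0 implybT.
    by congr (_ `^ _); ring.
  have -> : normc z ^+ (2 * n + 1) = normc z `^ (1 - nu) * normc z `^ ((2 * n)%:R + nu).
    rewrite -powRD; last by rewrite n0' implybT.
    rewrite -powR_mulrn; last exact: ltW.
    by congr (_ `^ _); rewrite natrD; ring.
  rewrite powR_invn // exprM -natrX [2 `^ (- nu)]powRN.
  have p0 : 2 `^ nu != 0 :> R by rewrite gt_eqF // powR_gt0.
  have -> : (2 ^ 2)%N%:R = 4 :> R by [].
  have q0 : 4 ^+ n != 0 :> R by rewrite expf_neq0.
  by field; rewrite p0 q0.
rewrite rmorphM rmorphXn /= -mulrA -exprMn; congr (_ * _ ^+ _).
exact: cis_carg.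
Qed.

Lemma g_besselJ nu z : -1 < nu -> z != 0 ->
  g nu z = (2 `^ nu * gamma (nu + 1))%:C * cpow z (1 - nu) * besselJ nu z.
Proof.
move=> hnu z0; have b0 := nu1_gt0 hnu.
pose k := (2 `^ nu * gamma (nu + 1))%:C * cpow z (1 - nu).
have gam0 := gamma_gt0 b0.
have real_neq0 (x : R) : 0 < x -> x%:C != 0.
  by move=> x0; rewrite -(rmorph0 (real_complex R)) (inj_eq (@complexI _)) gt_eqF.
have n0 : 0 < normc z.
  by rewrite lt0r normc_ge0 andbT; apply: contraNneq z0 => /normc_eq0 ->.
have k0 : k != 0.
  by rewrite !mulf_neq0 ?cis_neq0 ?real_neq0 ?mulr_gt0 ?powR_gt0.
have h := geo_bounded_hassum (conv_at_norm (entire_bcoef b0 (normc_ge0 (z ^+ 2))) (lexx _)).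
rewrite -/k -[LHS](mulVKf k0); congr (_ * _); apply/esym.
apply: hassum_cseries; rewrite g_power_series // mulrA.
rewrite (_ : (fun _ => _) = fun n => k^-1 * z * pterm (bcoef (nu + 1)) (z ^+ 2) n).
  exact: hassumZ h.
apply/funext => n; apply: (mulfI k0).
rewrite -[k^-1 * z * _]mulrA mulVKf //.
have -> : n%:R + nu + 1 = nu + 1 + n%:R by ring.
rewrite gammaDn //.
have -> : k * (((-1) ^+ n / (n`!%:R * (rising (nu + 1) n * gamma (nu + 1))))%:C
   * cpow (z / 2) ((2 * n)%:R + nu)) =
   ((-1) ^+ n / (n`!%:R * rising (nu + 1) n))%:C *
   ((2 `^ nu)%:C * cpow z (1 - nu) * cpow (z / 2) ((2 * n)%:R + nu)).
  have r0 := rising_gt0 n b0.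
  have f0 : 0 < n`!%:R :> R by rewrite ltr0n fact_gt0.
  have e : 2 `^ nu * gamma (nu + 1) *
      ((-1) ^+ n / (n`!%:R * (rising (nu + 1) n * gamma (nu + 1)))) =
      (-1) ^+ n / (n`!%:R * rising (nu + 1) n) * 2 `^ nu.
    move: (gamma _) (rising _ _) n`!%:R (2 `^ nu) gam0 r0 f0 => G r f p *.
    by field; rewrite !gt_eqF.
  have := congr1 (real_complex R) e; rewrite !(rmorphM (real_complex R)) /= => e'.
  rewrite /k !(rmorphM (real_complex R)) /=.
  transitivity ((2 `^ nu)%:C * (gamma (nu + 1))%:C * (((-1) ^+ n)%:C *
     ((n`!%:R * (rising (nu + 1) n * gamma (nu + 1)))^-1)%:C) *
     (cpow z (1 - nu) * cpow (z / 2) ((2 * n)%:R + nu))); first by ring.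
  by rewrite e'; ring.
rewrite cpow_mul // mulrA -rmorphM.
rewrite /pterm -exprM addn1 exprS [RHS]mulrCA; congr (_%:C * _).
 rewrite /bcoef !invfM -exprVn; ring.
Qed.

End BesselSeries.

(** * The logarithmic derivative of a limit function *)

Section LaguerrePolya.
Local Open Scope classical_set_scope.
Variable R : realType.
Variable c : nat -> R.
Hypothesis c_lp : lp_limit c.
Hypothesis c_0 : c 0%N = 1.
Hypothesis c_entire : entire c.
Hypothesis w0_gt0 : 0 < neg_log_deriv c 0.
Hypothesis w1_gt0 : 0 < neg_log_deriv c 1.

Local Notation w := (neg_log_deriv c).
Local Notation M := (rate w).

Lemma log_deriv_newton n : convol c w n = - (n.+1%:R * c n.+1).
Proof. exact: convol_log_deriv. Qed.

Let M0 : 0 < M. Proof. exact: (rate_gt0 c_lp c_0 log_deriv_newton w0_gt0 w1_gt0). Qed.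

Let wpos n : 0 < w n. Proof. exact: (w_gt0 c_lp c_0 log_deriv_newton w0_gt0 w1_gt0). Qed.

Let w_bound n : `|w n| <= w 0 * M ^+ n.
Proof.
by rewrite ger0_norm ?(ltW (wpos n)) // (w_le_geometric c_lp c_0 log_deriv_newton w0_gt0 w1_gt0).
Qed.

Let w_ge n : M ^+ n.+1 <= w n.
Proof. exact: (rate_exp_le c_lp c_0 log_deriv_newton w0_gt0 w1_gt0). Qed.

Lemma lp_neq0 x : M * normc x < 1 -> cps c x != 0.
Proof. exact: (cps_neq0 c_0 c_entire M0 w_bound). Qed.

Lemma lp_log_deriv x : M * normc x < 1 ->
  cps c x * cps w x = - cps (dcoef c) x.
Proof. exact: (cps_log_deriv c_0 c_entire M0 w_bound). Qed.

Lemma lp_root : cps c M^-1%:C = 0.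
Proof. exact: (cps_root c_0 c_entire M0 w_bound w_ge). Qed.

Lemma lp_conv t : 0 <= t -> M * t < 1 -> conv_at w t.
Proof. exact: (conv_at_log_deriv M0 w_bound). Qed.

(** This is - t c'(t) / c(t) on the real axis, i.e. minus the derivative of log c with
    respect to log t. *)
Definition theta_log (t : R) : R := t * rps w t.

Lemma theta_log_lt s t : 0 <= s -> s < t -> M * t < 1 -> theta_log s < theta_log t.
Proof.
move=> s0 st Mt; have t0 : 0 < t by apply: le_lt_trans st.
have Ms : M * s < 1 by apply: lt_trans Mt; rewrite ltr_pM2l.
have h : rps w s <= rps w t.
  apply: rps_le; rewrite ?(ltW t0) //; [exact: lp_conv|exact: lp_conv (ltW t0) Mt|].
  move=> n; apply: ler_wpM2l; first exact: ltW.
  by rewrite lerXn2r // ?nnegrE ltW.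
have p : 0 < rps w t.
  apply: lt_le_trans (rps_ge_geometric (ltW M0) (ltW t0) Mt (lp_conv (ltW t0) Mt) w_ge).
  by rewrite divr_gt0 // subr_gt0.
rewrite /theta_log; apply: (@le_lt_trans _ _ (s * rps w t)); first by rewrite ler_wpM2l.
by rewrite ltr_pM2r.
Qed.

(** All the coefficients of the logarithmic derivative are nonnegative. *)
Lemma theta_log_norm x : M * normc x < 1 ->
  normc (x * cps w x) <= theta_log (normc x).
Proof.
move=> Mx; rewrite normcM ler_wpM2l ?normc_ge0 //.
apply: cps_norm_le; first by move=> n; exact: ltW.
by apply: lp_conv => //; exact: normc_ge0.
Qed.

Lemma theta_log_real t : 0 <= t -> M * t < 1 ->
  t%:C * cps w t%:C = (theta_log t)%:C.
Proof.
move=> t0 Mt; rewrite (rps_spec (t := t) _).2 ?rmorphM //.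
by rewrite ger0_norm //; exact: lp_conv.
Qed.

(** The function vanishes at 0, is continuous and tends to infinity at 1 / rate: at
    distance Y / (v + 1) from Y = 1 / rate it is already at least v. *)
Lemma theta_log_ivt v : 0 < v -> exists t, [/\ 0 < t, M * t < 1 & theta_log t = v].
Proof.
move=> v0; pose Y := M^-1; have Y0 : 0 < Y by rewrite invr_gt0.
have MY : M * Y = 1 by rewrite divff // gt_eqF.
have v1 : 0 < v + 1 by lra.
pose d := Y / (v + 1); have d0 : 0 < d by rewrite divr_gt0.
have dY : d < Y by rewrite ltr_pdivrMr // ltr_pMr //; lra.
pose t1 := Y - d; have t10 : 0 < t1 by rewrite subr_gt0.
have Md : M * t1 = 1 - M * d by rewrite mulrBr MY.
have Mt1 : M * t1 < 1 by rewrite Md gtrBl mulr_gt0.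
have large : v <= theta_log t1.
  have h := rps_ge_geometric (ltW M0) (ltW t10) Mt1 (lp_conv (ltW t10) Mt1) w_ge.
  apply: le_trans (ler_wpM2l (ltW t10) h).
  rewrite Md subKr invfM mulVKf ?gt_eqF //.
  by rewrite /t1 /d le_eqVlt; apply/orP; left; apply/eqP; field; rewrite !gt_eqF.
(* Continuity on [0, t1] comes from the Lipschitz property on the larger disc of radius t2. *)
pose t2 := Y - d / 2.
have t20 : 0 < t2 by rewrite /t2; lra.
have Mt2 : M * t2 < 1 by rewrite mulrBr MY gtrBl mulr_gt0 // divr_gt0.
have [K K0 hK] := cps_lipschitz t20 (lp_conv (ltW t20) Mt2).
have cont x : 0 <= x -> x <= t1 -> {for x, continuous theta_log}.
  move=> x0 x1; have {}x1 : x <= Y - d by exact: x1.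
  have Mn (u : R) : `|u| <= t2 -> M * `|u| < 1.
    by move=> ut; apply: le_lt_trans Mt2; rewrite ler_wpM2l // ltW.
  apply: cvgM; first exact: cvg_id.
  apply/cvgrPdist_lt => e e0; near=> y.
  have yx : `|x - y| < Num.min (d / 2) (e / (K + 1)).
    near: y; apply: cvgr_dist_lt; first exact: cvg_id.
    by rewrite lt_min !divr_gt0 //; lra.
  move: yx; rewrite lt_min => /andP[yx1 yx2].
  have xt2 : `|x| <= t2 by rewrite ger0_norm //; rewrite /t2; lra.
  have yt2 : `|y| <= t2.
    have := ler_normB x (x - y); rewrite subKr (ger0_norm x0) => h.
    apply: (le_trans h); rewrite /t2; lra.
  have := hK x%:C y%:C; rewrite !normc_real -rmorphB normc_real.
  rewrite (rps_spec (lp_conv (normr_ge0 _) (Mn x xt2))).2.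
  rewrite (rps_spec (lp_conv (normr_ge0 _) (Mn y yt2))).2.
  rewrite -rmorphB normc_real => /(_ xt2 yt2) h; apply: (le_lt_trans h).
  apply: (@le_lt_trans _ _ ((K + 1) * `|x - y|)).
    by rewrite ler_wpM2r // lerDl.
  by rewrite mulrC -ltr_pdivlMr //; lra.
have [] := @IVT R theta_log 0 t1 v (ltW t10) (continuous_in_subspaceT _).
- by move=> x; rewrite inE /= in_itv /= => /andP[]; exact: cont.
- have -> : theta_log 0 = 0 by rewrite /theta_log mul0r.
  by rewrite ge_min (ltW v0) le_max large orbT.
move=> t; rewrite in_itv /= => /andP[t0 tt1] e; exists t; split=> //.
  rewrite lt_neqAle t0 andbT; apply: contraTneq v0 => t00.
  by rewrite -e -t00 /theta_log mul0r ltxx.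
by apply: le_lt_trans Mt1; rewrite ler_pM2l.
Unshelve. all: by end_near. Qed.

End LaguerrePolya.

(** * Derivatives of the normalized Bessel function *)

Section BesselDerivatives.
Local Open Scope classical_set_scope.
Variables (R : realType) (nu : R).
Hypothesis hnu : -1 < nu.
Let b0 : 0 < nu + 1 := nu1_gt0 hnu.
Implicit Types (a : nat -> R) (t : R) (x z : R[i]).

Definition gcoef n : R := (2^-1 + n%:R) / 2^-1 * bcoef (nu + 1) n.

Lemma kappaE : kappa nu = fun n => (4^-1 + n%:R) / 4^-1 * gcoef n.
Proof.
apply/funext => n; rewrite /kappa /gcoef /bcoef.
have -> : 2 ^+ (2 * n) = 4 ^+ n :> R by rewrite exprM -natrX.
have -> : ((2 * n + 1) * (4 * n + 1))%N%:R = (2 * n%:R + 1) * (4 * n%:R + 1) :> R.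
  by rewrite natrM !natrD; ring.
by rewrite !mulrA; congr (_ / _); field.
Qed.

Lemma entire_gcoef : entire gcoef.
Proof. by apply: entire_affine; [rewrite invr_gt0|exact: entire_bcoef]. Qed.

Lemma entire_kappa : entire (kappa nu).
Proof. by rewrite kappaE; apply: entire_affine; [rewrite invr_gt0|exact: entire_gcoef]. Qed.

Lemma lp_gcoef : lp_limit gcoef.
Proof. by apply: lp_limit_rolle_op; [rewrite invr_gt0|exact: lp_limit_bessel]. Qed.

Lemma lp_kappa : lp_limit (kappa nu).
Proof. by rewrite kappaE; apply: lp_limit_rolle_op; [rewrite invr_gt0|exact: lp_gcoef]. Qed.

Lemma entire_ntimes a : entire a -> entire (fun n => n%:R * a n).
Proof.
move=> ha t t0; apply: (geo_bounded_weight (ha _ t0)) => n.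
rewrite !normc_pterm normrM normr_nat -mulrA ler_wpM2r ?mulr_ge0 ?exprn_ge0 ?normc_ge0 //.
by rewrite ler_nat.
Qed.

(** Both sides are the series of x c'(x); they differ by a shift of the index. *)
Lemma cps_theta a x : entire a ->
  cps (fun n => n%:R * a n) x = x * cps (dcoef a) x.
Proof.
move=> ha; have x0 := normc_ge0 x.
have h1 := geo_bounded_hassum (conv_at_norm (entire_ntimes ha x0) (lexx _)).
have h2 := geo_bounded_hassum (conv_at_norm (entire_dcoef ha x0) (lexx _)).
have h3 := hassum_tail (m := 1) h1.
have h4 := hassumZ (a := x) h2.
have e : (fun n => pterm (fun n => n%:R * a n) x (n + 1)%N) =
    (fun n => x * pterm (dcoef a) x n).
  apply/funext => n; rewrite /pterm addn1 exprS /dcoef; ring.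
rewrite e in h3; have := hassum_cseries h3; rewrite (hassum_cseries h4) /series /=.
by rewrite big_nat1 /pterm mul0r mul0r subr0 => ->.
Qed.

Lemma geo_bounded_odd_even a (e : nat) t : (e <= 1)%N -> 0 <= t -> entire a ->
  geo_bounded (fun n => ((2 * n + e).+1%:R ^+ 2 * a n * t ^+ (2 * n + e))%:C).
Proof.
move=> e1 t0 ha; have t2 : 0 <= t ^+ 2 by exact: sqr_ge0.
have h1 : geo_bounded (pterm (fun n => n.+1%:R * a n) (t ^+ 2)%:C).
  apply: (geo_bounded_weight (ha _ t2)) => n.
  by rewrite !normc_pterm normrM normr_nat mulrA.
have h2 : geo_bounded (pterm (fun n => n.+1%:R * (n.+1%:R * a n)) (t ^+ 2)%:C).
  apply: (geo_bounded_weight h1) => n.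
  by rewrite !normc_pterm [in leLHS]normrM normr_nat mulrA.
have te : 0 <= 4 * t ^+ e by rewrite mulr_ge0 ?exprn_ge0.
apply: (geo_bounded_le te h2) => n.
rewrite normc_pterm !normc_real (ger0_norm t2) (normrM n.+1%:R) (normrM n.+1%:R).
rewrite (normrM _ (t ^+ _)) (normrM _ (a n)) !normrX !normr_nat (ger0_norm t0).
rewrite exprD exprM.
have -> : 4 * t ^+ e * (n.+1%:R * (n.+1%:R * `|a n|) * t ^+ 2 ^+ n) =
  (2 * n.+1%:R) ^+ 2 * (`|a n| * (t ^+ 2 ^+ n * t ^+ e)) by ring.
rewrite -mulrA ler_wpM2r ?mulr_ge0 ?exprn_ge0 //.
by rewrite lerXn2r ?nnegrE // -natrM ler_nat; lia.
Qed.

Lemma cderiv_g z : cderiv (g nu) z = cps gcoef (z ^+ 2).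
Proof.
have t0 : 0 <= normc z + 1 by have := normc_ge0 z; lra.
rewrite -[g nu]/(fun x => cseries (fun n => (bcoef (nu + 1) n)%:C * x ^+ (2 * n + 1))).
rewrite (cderiv_series (m := fun n => (2 * n + 1)%N) (lexx _)
  (geo_bounded_odd_even (leqnn 1) t0 (entire_bcoef b0))).
congr cseries; apply/funext => n; rewrite /pterm addn1 /= -exprM; congr (_%:C * _).
by rewrite /gcoef -natr1 natrM; field.
Qed.

(** The extra factor z makes all the exponents even again, including the term n = 0,
    whose coefficient vanishes. *)
Lemma mul_cderiv2_g z : z * cderiv (cderiv (g nu)) z =
  2 * (z ^+ 2 * cps (dcoef gcoef) (z ^+ 2)).
Proof.
have t0 : 0 <= normc z + 1 by have := normc_ge0 z; lra.
have -> : cderiv (g nu) = fun x => cseries (fun n => (gcoef n)%:C * x ^+ (2 * n + 0)).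
  apply/funext => x; rewrite cderiv_g; congr cseries; apply/funext => n.
  by rewrite /pterm addn0 exprM.
rewrite (cderiv_series (m := fun n => (2 * n + 0)%N) (lexx _)
  (geo_bounded_odd_even (leq0n 1) t0 entire_gcoef)).
rewrite -(cps_theta _ entire_gcoef).
have h := geo_bounded_hassum (conv_at_norm
  (entire_ntimes entire_gcoef (normc_ge0 (z ^+ 2))) (lexx _)).
have [->|z0] := eqVneq z 0.
  by rewrite mul0r (cps_theta _ entire_gcoef) expr0n /= mul0r mulr0.
rewrite -[RHS](mulVKf z0); congr (_ * _); rewrite mulrA.
apply: hassum_cseries.
rewrite (_ : (fun _ => _) = fun n => z^-1 * 2 * pterm (fun n => n%:R * gcoef n) (z ^+ 2) n).
  exact: hassumZ h.
apply/funext => n; apply: (mulfI z0).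
rewrite -[z^-1 * 2 * _]mulrA mulVKf // /pterm addn0 -exprM mulrCA.
case: n => [|n]; first by rewrite muln0 mulr0 mul0r !mul0r mulr0.
have -> : z * z ^+ (2 * n.+1).-1 = z ^+ (2 * n.+1) by rewrite -exprS prednK.
rewrite natrM [RHS]mulrA; congr (_ * _).
by move: (gcoef _) => a; rewrite !rmorphM /= !rmorph_nat; ring.
Qed.

Lemma cderiv_equation z :
  cderiv (g nu) z + 2 * z * cderiv (cderiv (g nu)) z = cps (kappa nu) (z ^+ 2).
Proof.
rewrite -mulrA mul_cderiv2_g cderiv_g kappaE.
move: (z ^+ 2) => x; have x0 := normc_ge0 x.
have h1 := geo_bounded_hassum (conv_at_norm (entire_gcoef x0) (lexx _)).
have h2 := geo_bounded_hassum (conv_at_norm (entire_ntimes entire_gcoef x0) (lexx _)).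
rewrite -(cps_theta _ entire_gcoef) mulrA; apply/esym/hassum_cseries.
rewrite (_ : pterm _ x = fun n => pterm gcoef x n + 2 * 2 * pterm (fun n => n%:R * gcoef n) x n).
  exact: hassumD h1 (hassumZ h2).
apply/funext => n; rewrite /pterm.
have -> : (4^-1 + n%:R) / 4^-1 * gcoef n = gcoef n + 2 * 2 * (n%:R * gcoef n).
  by field.
by move: (gcoef n) => a; rewrite rmorphD !rmorphM /= !rmorph_nat; ring.
Qed.

Lemma bcoef0 : bcoef (nu + 1) 0 = 1.
Proof. by rewrite /bcoef /rising big_ord0 !expr0 !mulr1 divr1. Qed.

Lemma gcoef0 : gcoef 0 = 1.
Proof. by rewrite /gcoef bcoef0 addr0 divff ?mulr1 // invr_neq0. Qed.

Lemma log_deriv_rec (c : nat -> R) n : c 0%N = 1 ->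
  neg_log_deriv c n = - (n.+1%:R * c n.+1) - \sum_(i < n) c i.+1 * neg_log_deriv c (n - i.+1)%N.
Proof. by move=> c0; apply: newton_solve => //; exact: convol_log_deriv. Qed.

Lemma gcoef_log_deriv_gt0 : 0 < neg_log_deriv gcoef 0 /\ 0 < neg_log_deriv gcoef 1.
Proof.
have b1 : 0 < nu + 1 + 1 by exact: addr_gt0.
have c1 : gcoef 1 = - (3 / (4 * (nu + 1))).
  rewrite /gcoef bcoefS // bcoef0 addr0; field; rewrite ?gt_eqF //.
have c2 : gcoef 2 = 5 / (32 * ((nu + 1) * (nu + 1 + 1))).
  rewrite /gcoef !bcoefS // bcoef0 addr0; field; rewrite ?gt_eqF //.
have w0 : neg_log_deriv gcoef 0 = 3 / (4 * (nu + 1)).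
  by rewrite log_deriv_rec ?gcoef0 // big_ord0 c1; field; rewrite gt_eqF.
have w1 : neg_log_deriv gcoef 1 = (4 * (nu + 1) + 9) / (16 * (nu + 1) ^+ 2 * (nu + 1 + 1)).
  rewrite log_deriv_rec ?gcoef0 // big_ord_recr big_ord0 /= w0 c1 c2.
  by field; rewrite !gt_eqF.
split; first by rewrite w0 divr_gt0 // mulr_gt0.
by rewrite w1 divr_gt0 ?mulr_gt0 ?exprn_gt0 //; lra.
Qed.

End BesselDerivatives.

Section KappaLogDeriv.
Variables (R : realType) (nu : R).
Hypothesis hnu : -1 < nu.

(** The first four power sums of the reciprocal zeros of P, from Newton's identities.
    Positivity of the second Hankel determinant comes from the positive coefficients of
    its numerator as a polynomial in nu + 1. *)
Lemma kappa_log_deriv :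
  let a := nu + 1 in
  [/\ neg_log_deriv (kappa nu) 0 = 15 / (4 * a),
      neg_log_deriv (kappa nu) 1 = 45 * (4 * a + 5) / (16 * a ^+ 2 * (a + 1)) &
      0 < hankel2 (neg_log_deriv (kappa nu)) 1].
Proof.
move=> a; have a0 : 0 < a by exact: nu1_gt0.
have k0 := kappa0 nu.
have a1 : 0 < a + 1 by rewrite addr_gt0.
have a2 : 0 < a + 2 by rewrite addr_gt0.
have a3 : 0 < a + 3 by rewrite addr_gt0.
have k1 : kappa nu 1 = - (15 / (4 * a)).
  rewrite kappaE /gcoef !bcoefS // bcoef0 -/a addr0; field; by rewrite ?gt_eqF.
have k2 : kappa nu 2 = 45 / (32 * (a * (a + 1))).
  rewrite kappaE /gcoef !bcoefS // bcoef0 -/a addr0; field; by rewrite ?gt_eqF.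
have k3 : kappa nu 3 = - (91 / (384 * (a * (a + 1) * (a + 2)))).
  rewrite kappaE /gcoef !bcoefS // bcoef0 -/a addr0; field; by rewrite ?gt_eqF.
have k4 : kappa nu 4 = 51 / (2048 * (a * (a + 1) * (a + 2) * (a + 3))).
  rewrite kappaE /gcoef !bcoefS // bcoef0 -/a addr0; field; by rewrite ?gt_eqF.
have w0 : neg_log_deriv (kappa nu) 0 = 15 / (4 * a).
  by rewrite log_deriv_rec // big_ord0 k1; field; rewrite gt_eqF.
have w1 : neg_log_deriv (kappa nu) 1 = 45 * (4 * a + 5) / (16 * a ^+ 2 * (a + 1)).
  rewrite log_deriv_rec // big_ord_recr big_ord0 /= w0 k1 k2.
  by field; rewrite !gt_eqF.
have w2 : neg_log_deriv (kappa nu) 2 =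
    (1204 * a ^+ 2 + 4050 * a + 3375) / (32 * a ^+ 3 * (a + 1) * (a + 2)).
  rewrite log_deriv_rec // !big_ord_recr big_ord0 /= w0 w1 k1 k2 k3.
  by field; rewrite !gt_eqF.
(* Large numerals are written as products because they are unary. *)
have w3 : neg_log_deriv (kappa nu) 3 =
    (16 * 2017 * a ^+ 4 + 16 * 31 * 487 * a ^+ 3 + 120 * 5389 * a ^+ 2 + 125 * 5913 * a + 3750 * 81) /
    (256 * a ^+ 4 * (a + 1) ^+ 2 * (a + 2) * (a + 3)).
  rewrite log_deriv_rec // !big_ord_recr big_ord0 /= w0 w1 w2 k1 k2 k3 k4.
  by field; rewrite !gt_eqF.
split=> //; rewrite /hankel2 w1 w2 w3.
have -> : 45 * (4 * a + 5) / (16 * a ^+ 2 * (a + 1)) *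
    ((16 * 2017 * a ^+ 4 + 16 * 31 * 487 * a ^+ 3 + 120 * 5389 * a ^+ 2 + 125 * 5913 * a + 3750 * 81) /
    (256 * a ^+ 4 * (a + 1) ^+ 2 * (a + 2) * (a + 3))) -
    ((1204 * a ^+ 2 + 4050 * a + 3375) / (32 * a ^+ 3 * (a + 1) * (a + 2))) ^+ 2 =
    (256 * 41 * a ^+ 4 + 16 * 9689 * a ^+ 3 + 32 * 41 * 519 * a ^+ 2 + 900 * 1331 * a + 125 * 6021) /
    (4096 * a ^+ 4 * (a + 1) ^+ 3 * (a + 2) ^+ 2 * (a + 3)).
  by field; rewrite !gt_eqF.
have pw k : 0 < a ^+ k by exact: exprn_gt0.
apply: divr_gt0.
  by have := pw 4; have := pw 3; have := pw 2; move=> ? ? ?; lra.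
have c0 : 0 < 4096 :> R by rewrite ltr0n.
apply: mulr_gt0 a3; apply: mulr_gt0 (exprn_gt0 _ a2).
apply: mulr_gt0 (exprn_gt0 _ a1); exact: mulr_gt0 c0 (pw 4).
Qed.

End KappaLogDeriv.

(** * Radii of convexity and bounds for the first root *)

Lemma half_add_half (R : numFieldType) : 2^-1 + 2^-1 = 1 :> R.
Proof. by field. Qed.

Lemma lt_1B_quarter (R : realFieldType) (x : R) : x < 2 * 4^-1 -> x < 1 - x.
Proof. lra. Qed.

Section UniformConvexity.
Variables (R : realType) (nu : R).
Hypothesis hnu : -1 < nu.
Implicit Types (x z : R[i]) (t : R).

Local Notation G := (gcoef nu).
Local Notation P := (kappa nu).
Local Notation M := (rate (neg_log_deriv G)).
Local Notation L := (rate (neg_log_deriv P)).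

Let Glp := lp_gcoef hnu.
Let Gent := entire_gcoef hnu.
Let G0 := gcoef0 nu.
Let Gw0 := (gcoef_log_deriv_gt0 hnu).1.
Let Gw1 := (gcoef_log_deriv_gt0 hnu).2.
Let Plp := lp_kappa hnu.
Let Pent := entire_kappa hnu.
Let P0 := kappa0 nu.
Let b0 : 0 < nu + 1 := nu1_gt0 hnu.
Let b1 : 0 < nu + 1 + 1. Proof. exact: addr_gt0. Qed.
Let Pw0 : 0 < neg_log_deriv P 0.
Proof. by have [-> _ _] := kappa_log_deriv hnu; rewrite divr_gt0 // mulr_gt0. Qed.
Let Pw1 : 0 < neg_log_deriv P 1.
Proof.
have [_ -> _] := kappa_log_deriv hnu; apply: divr_gt0.
  by rewrite mulr_gt0 // addr_gt0 // mulr_gt0.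
by rewrite !mulr_gt0 // exprn_gt0.
Qed.

Local Notation th := (theta_log G).

Lemma rate_gcoef_gt0 : 0 < M. Proof. exact: (rate_gt0 Glp G0 (log_deriv_newton G0) Gw0 Gw1). Qed.
Lemma rate_kappa_gt0 : 0 < L. Proof. exact: (rate_gt0 Plp P0 (log_deriv_newton P0) Pw0 Pw1). Qed.

Lemma cps_kappaE x : cps P x = cps G x + 4 * (x * cps (dcoef G) x).
Proof.
have := cderiv_equation hnu (sqrtc x); rewrite sqr_sqrtc => <-.
by rewrite -mulrA mul_cderiv2_g // cderiv_g // sqr_sqrtc mulrA -natrM.
Qed.

(** From P = G + 4 x G' and - x G' = G S. *)
Lemma cps_kappa_factor x : M * normc x < 1 ->
  cps P x = cps G x * (1 - 4 * (x * cps (neg_log_deriv G) x)).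
Proof.
move=> Mx; have e := lp_log_deriv Glp G0 Gent Gw0 Gw1 Mx.
rewrite cps_kappaE -[cps (dcoef G) x]opprK -e; ring.
Qed.

Lemma convexity_quotient_g z : M * normc (z ^+ 2) < 1 ->
  cderiv (g nu) z != 0 /\
  convexity_quotient (g nu) z = - (2 * (z ^+ 2 * cps (neg_log_deriv G) (z ^+ 2))).
Proof.
move=> Mz; have n0 := lp_neq0 Glp G0 Gent Gw0 Gw1 Mz.
rewrite /convexity_quotient mul_cderiv2_g // cderiv_g //; split; first exact: n0.
have e := lp_log_deriv Glp G0 Gent Gw0 Gw1 Mz.
rewrite -[cps (dcoef G) _]opprK -e; field.
exact: n0.
Qed.

Lemma normc_convexity_quotient_g z : M * normc (z ^+ 2) < 1 ->
  normc (convexity_quotient (g nu) z) <= 2 * th (normc (z ^+ 2)).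
Proof.
move=> Mz; rewrite (convexity_quotient_g Mz).2 normcN normcM.
have -> : normc (2 : R[i]) = 2.
  by rewrite -(rmorph_nat (real_complex R)) normc_real normr_nat.
by apply: ler_wpM2l => //; exact: theta_log_norm.
Qed.

Let X := L^-1.
Let X0 : 0 < X. Proof. by rewrite invr_gt0; exact: rate_kappa_gt0. Qed.

(** The point where S = 1/4 is a zero of P, so it is not smaller than the zero X of P
    nearest to 0; hence X lies in the disc where G has no zero, and there P(X) = 0
    means S(X) = 1/4. *)
Lemma theta_log_first_root : M * X < 1 /\ th X = 4^-1.
Proof.
have [t [t0 Mt tE]] := theta_log_ivt Glp G0 Gw0 Gw1 (v := 4^-1) ltac:(by rewrite invr_gt0).
have four (u : R[i]) : u = (4^-1)%:C -> 1 - 4 * u = 0.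
  by move=> ->; rewrite fmorphV rmorph_nat divff ?subrr // pnatr_eq0.
have nt : normc t%:C = t by rewrite normc_real ger0_norm // ltW.
have Pt : cps P t%:C = 0.
  rewrite cps_kappa_factor ?nt // (theta_log_real Glp G0 Gw0 Gw1 (ltW t0) Mt) tE.
  by rewrite four ?mulr0.
have Xt : X <= t.
  rewrite leNgt; apply/negP => tX; move: Pt; apply/eqP.
  apply: (lp_neq0 Plp P0 Pent Pw0 Pw1); rewrite nt.
  by rewrite -(divff (lt0r_neq0 rate_kappa_gt0)) ltr_pM2l // rate_kappa_gt0.
have MX : M * X < 1 by apply: le_lt_trans Mt; rewrite ler_pM2l // rate_gcoef_gt0.
split; first exact: MX.
have nX : normc X%:C = X by rewrite normc_real ger0_norm // ltW.
have MnX : M * normc X%:C < 1 by rewrite nX; exact: MX.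
have Pr : cps P X%:C = 0 by exact: (lp_root Plp P0 Pent Pw0 Pw1).
have Gr := lp_neq0 Glp G0 Gent Gw0 Gw1 MnX.
move: Pr; rewrite (cps_kappa_factor MnX) => /eqP; rewrite mulf_eq0 (negbTE Gr) orFb.
rewrite (theta_log_real Glp G0 Gw0 Gw1 (ltW X0) MX) subr_eq0 => /eqP e.
apply: complexI; rewrite fmorphV rmorph_nat.
by apply: (mulfI (_ : 4 != 0)); rewrite ?pnatr_eq0 // divff ?pnatr_eq0.
Qed.

Let r := Num.sqrt X.
Let r0 : 0 < r. Proof. by rewrite sqrtr_gt0. Qed.
Let r2 : r ^+ 2 = X. Proof. by rewrite sqr_sqrtr // ltW. Qed.

Lemma normc_sqr_lt z (s : R) : 0 < s -> `|z| < s%:C -> normc (z ^+ 2) < s ^+ 2.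
Proof.
move=> s0; rewrite complex_normE ltcR => h.
by rewrite normcX ltrXn2r ?normc_ge0.
Qed.

(** Here t is the point where S takes the value v. *)
Lemma convexity_quotient_bound z (t v : R) : 0 < t -> M * t < 1 -> th t = v ->
  normc (z ^+ 2) < t ->
  [/\ cderiv (g nu) z != 0 & normc (convexity_quotient (g nu) z) < 2 * v].
Proof.
move=> t0 Mt tE zt.
have Mz : M * normc (z ^+ 2) < 1.
  by apply: lt_trans Mt; rewrite ltr_pM2l // rate_gcoef_gt0.
split; first by have [] := convexity_quotient_g Mz.
apply: (le_lt_trans (normc_convexity_quotient_g Mz)); rewrite ltr_pM2l // -tE.
by apply: (theta_log_lt Glp G0 Gw0 Gw1); rewrite ?normc_ge0.
Qed.

Lemma Re_1D z : complex.Re (1 + z) = 1 + complex.Re z.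
Proof. by case: z. Qed.

Lemma Re_1D_ge z : 1 - normc z <= complex.Re (1 + z).
Proof.
rewrite Re_1D lerD2l; have := normc_ge_Re z; rewrite ler_norml => /andP[h _].
exact: h.
Qed.

(** Convexity holds until S reaches 1/2, strictly later than 1/4. *)
Lemma radius_convexity_gt : (r%:E < radius_convexity (g nu))%E.
Proof.
have [MX thX] := theta_log_first_root.
have [t [t0 Mt tE]] := theta_log_ivt Glp G0 Gw0 Gw1 (v := 2^-1) ltac:(by rewrite invr_gt0).
have Xt : X < t.
  rewrite ltNge; apply/negP; rewrite le_eqVlt => /predU1P[e|h].
    by move: tE; rewrite e thX; lra.
  have lt1 := theta_log_lt Glp G0 Gw0 Gw1 (ltW t0) h MX.
  by move: lt1; rewrite tE thX ltf_pV2 ?posrE ?ltr0n // ltr_nat.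
apply: (@lt_le_trans _ _ (Num.sqrt t)%:E); first by rewrite lte_fin ltr_sqrt.
apply: ereal_sup_ubound; exists (Num.sqrt t) => //; split; first by rewrite sqrtr_gt0.
move=> z /(normc_sqr_lt _); rewrite sqrtr_gt0 sqr_sqrtr ?(ltW t0) // => /(_ t0) zt.
have [d q] := convexity_quotient_bound t0 Mt tE zt; split; first exact: d.
by apply: lt_le_trans (Re_1D_ge _); rewrite subr_gt0 (lt_le_trans q) // divff ?pnatr_eq0.
Qed.

(** At z = r the quotient is -1/2, where its modulus equals the real part of one plus
    itself; this bounds the radius from above. *)
Lemma radius_uniform_convexity_g : radius_uniform_convexity (g nu) = r%:E.
Proof.
have [MX thX] := theta_log_first_root.
apply/eqP; rewrite eq_le; apply/andP; split.
  rewrite /radius_uniform_convexity. apply: ge_ereal_sup. move=> y ys. case: ys => s. case=> s0 _ hs. move=> <-. rewrite lee_fin leNgt. apply/negP => rs.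
  have [] := hs r%:C.
    by rewrite complex_normE normc_real ger0_norm ?(ltW r0) // ltcR.
  have rX : r%:C ^+ 2 = X%:C by rewrite -rmorphXn r2.
  have nX : normc (r%:C ^+ 2) = X by rewrite rX normc_real ger0_norm // ltW.
  have Mr : M * normc (r%:C ^+ 2) < 1 by rewrite nX.
  move=> _; rewrite (convexity_quotient_g Mr).2 rX.
  rewrite (theta_log_real Glp G0 Gw0 Gw1 (ltW X0) MX) thX.
  have -> : - (2 * (4^-1)%:C) = (- 2^-1)%:C :> R[i].
    rewrite -(rmorph_nat (real_complex R) 2) -rmorphM -rmorphN; congr (_%:C).
    by field.
  rewrite Re_1D normc_real normrN ger0_norm ?invr_ge0 //= ltrBrDr.
  by rewrite half_add_half ltxx.
apply: ereal_sup_ubound; exists r => //; split; [exact: r0|exact: radius_convexity_gt|].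
move=> z /(normc_sqr_lt r0); rewrite r2 => zX.
have [d q] := convexity_quotient_bound X0 MX thX zX; split; first exact: d.
by apply: lt_le_trans (Re_1D_ge _); exact: lt_1B_quarter.
Qed.

Lemma smallest_root_g : smallest_positive_root
  (fun z : R[i] => cderiv (g nu) z + 2 * z * cderiv (cderiv (g nu)) z) r.
Proof.
split; first exact: r0.
  rewrite cderiv_equation // -rmorphXn r2.
  exact: (lp_root Plp P0 Pent Pw0 Pw1).
move=> s s0; rewrite cderiv_equation // => Fs; rewrite leNgt; apply/negP => sr.
move: Fs; apply/eqP; apply: (lp_neq0 Plp P0 Pent Pw0 Pw1).
rewrite normcX normc_real (ger0_norm (ltW s0)).
rewrite -(divff (lt0r_neq0 rate_kappa_gt0)) ltr_pM2l ?rate_kappa_gt0 // -/X -r2.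
by rewrite ltrXn2r // ltW.
Qed.

Lemma euler_rayleigh k : (0 < k)%N ->
  omega nu k `^ (- k%:R^-1) < r ^+ 2 /\ r ^+ 2 < omega nu k / omega nu k.+1.
Proof.
case: k => // k _; rewrite !omega_log_deriv // r2.
have [_ _ D1] := kappa_log_deriv hnu.
have lo := rate_exp_lt Plp P0 (log_deriv_newton P0) Pw0 Pw1 D1 k.
have hi := w_lt_rate Plp P0 (log_deriv_newton P0) Pw0 Pw1 D1 k.
have wp n := w_gt0 Plp P0 (log_deriv_newton P0) Pw0 Pw1 n.
split.
  rewrite powRN ltf_pV2 ?posrE ?powR_gt0 ?rate_kappa_gt0 //.
  have -> : L = (L ^+ k.+1) `^ (k.+1%:R^-1).
    by rewrite -powR_mulrn ?(ltW rate_kappa_gt0) // -powRrM divff ?powRr1 ?(ltW rate_kappa_gt0).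
  by apply: gt0_ltr_powR lo; rewrite ?invr_gt0 // nnegrE ?exprn_ge0 ?(ltW rate_kappa_gt0) ?(ltW (wp k)).
by rewrite ltr_pdivlMr // mulrC ltr_pdivrMr ?rate_kappa_gt0 // mulrC.
Qed.

Lemma two_sqrt_lt (u : R) : 4 * u < r ^+ 2 -> 2 * Num.sqrt u < r.
Proof.
move=> h; have [u0|u0] := leP u 0; first by rewrite ler0_sqrtr // mulr0.
rewrite -(ltr_pXn2r (n := 2)) ?nnegrE ?(ltW r0) ?mulr_ge0 ?sqrtr_ge0 //.
have -> : (2 * Num.sqrt u) ^+ 2 = 4 * u.
  by rewrite exprMn sqr_sqrtr ?(ltW u0) // -natrX.
exact: h.
Qed.

Lemma lt_two_sqrt (u : R) : r ^+ 2 < 4 * u -> r < 2 * Num.sqrt u.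
Proof.
move=> h; have u0 : 0 <= u by have := sqr_ge0 r; lra.
rewrite -(ltr_pXn2r (n := 2)) ?nnegrE ?(ltW r0) ?mulr_ge0 ?sqrtr_ge0 //.
have -> : (2 * Num.sqrt u) ^+ 2 = 4 * u by rewrite exprMn sqr_sqrtr // -natrX.
exact: h.
Qed.

Lemma first_bounds :
  2 * Num.sqrt ((nu + 1) / 15) < r /\
  r < 2 * Num.sqrt ((nu + 1) * (nu + 2) / (3 * (4 * nu + 9))).
Proof.
have [e0 e1 D1] := kappa_log_deriv hnu.
have lo := rate_exp_lt Plp P0 (log_deriv_newton P0) Pw0 Pw1 D1 0.
have hi := w_lt_rate Plp P0 (log_deriv_newton P0) Pw0 Pw1 D1 0.
have hb : 0 < nu + 1 by exact: b0.
have s0 : 0 < 4 * nu + 9 by lra.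
have n2 : 0 < nu + 2 by lra.
split.
  apply: two_sqrt_lt; rewrite r2.
  have -> : 4 * ((nu + 1) / 15) = (neg_log_deriv P 0)^-1.
    by rewrite e0; field; rewrite ?gt_eqF.
  by rewrite ltf_pV2 ?posrE ?rate_kappa_gt0.
apply: lt_two_sqrt; rewrite r2.
have -> : 4 * ((nu + 1) * (nu + 2) / (3 * (4 * nu + 9))) = neg_log_deriv P 0 / neg_log_deriv P 1.
  rewrite e0 e1; have -> : 4 * (nu + 1) + 5 = 4 * nu + 9 by ring.
  have -> : nu + 1 + 1 = nu + 2 by ring.
  by field; rewrite ?gt_eqF.
by rewrite ltr_pdivlMr // mulrC ltr_pdivrMr ?rate_kappa_gt0 // mulrC.
Qed.

(** A weaker form of the upper bound of first_bounds:
    (nu+2) (4 nu - 1) < nu (4 nu + 9). *)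
Lemma first_bound_weak : 1 / 4 < nu ->
  r < 2 * Num.sqrt (nu * (nu + 1) / (3 * (4 * nu - 1))).
Proof.
move=> h; apply: (lt_trans first_bounds.2).
have s0 : 0 < 4 * nu + 9 by lra.
have s1 : 0 < 4 * nu - 1 by lra.
rewrite ltr_pM2l // ltr_sqrt; last first.
  by rewrite divr_gt0 ?mulr_gt0 //; lra.
rewrite ltr_pdivrMr ?mulr_gt0 // mulrAC ltr_pdivlMr ?mulr_gt0 //.
nra.
Qed.

End UniformConvexity.

Theorem lemma5 (R : realType) (nu : R) (hnu : -1 < nu) :
  (forall z : R[i], z != 0 ->
     g nu z = (2 `^ nu * gamma (nu + 1))%:C * cpow z (1 - nu) * besselJ nu z)
  /\ exists r : R,
    [/\ radius_uniform_convexity (g nu) = r%:E,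
        smallest_positive_root
          (fun z : R[i] =>
             cderiv (g nu) z + 2 * z * cderiv (cderiv (g nu)) z) r,
        (forall k : nat, (0 < k)%N ->
           omega nu k `^ (- k%:R^-1) < r ^+ 2
           /\ r ^+ 2 < omega nu k / omega nu k.+1),
        2 * Num.sqrt ((nu + 1) / 15) < r
        /\ r < 2 * Num.sqrt ((nu + 1) * (nu + 2) / (3 * (4 * nu + 9))) &
        (1 / 4 < nu ->
           r < 2 * Num.sqrt (nu * (nu + 1) / (3 * (4 * nu - 1))))].
Proof.
split; first by move=> z z0; exact: g_besselJ.
exists (Num.sqrt (rate (neg_log_deriv (kappa nu)))^-1); split.
- exact: radius_uniform_convexity_g.
- exact: smallest_root_g.
- by move=> k; exact: euler_rayleigh.
- exact: first_bounds.
- exact: first_bound_weak.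
Qed.
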